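(* Let $A$ be a (not necessarily bounded) $F$-chamber in $\mathcal{A}_\Gamma(\mathbf{x}_2)$, and let $\Gamma_A$ be the corresponding directed $\mathbf{x}$-graph. For $E$ a subset of the cuttable edges of $\Gamma_A$, consider the graph $\Gamma_{A,E}$ obtained from $\Gamma_A$ by reversing the edges in $E$. If it corresponds to an $F$-chamber in $\mathcal{A}_\Gamma(\mathbf{x}_1)$, denote this chamber $A_E$. Then $$\nabla^*_{\Gamma,12}(A)=\sum_{C\in \mathrm{Cuts}_I(\Gamma_A)}(-1)^{\mathrm{rk}(C)}\sum_{E\subset C}(-1)^{|E|}A_E .$$ If $\Gamma_{A,E}$ has sinks or sources, or if it corresponds to an $F$-chamber in $\mathcal{A}_\Gamma(\mathbf{x}_2)$ other than $A$, then $$\sum_{C\in \mathrm{Cuts}_I(\Gamma_A)\ \text{s.t.}\ E\subseteq C}(-1)^{\mathrm{rk}(C)}=0 .$$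
   Context: Graphs and flows. Let $V=\{\mathbf{x}\in\mathbb{R}^n:\sum x_i=0\}$. An $\mathbf{x}$-graph $\Gamma$ is a connected graph of genus (first Betti number) $g$ with $n$ one-valent vertices (leaves) and all other (internal) vertices 3-valent; the edges at leaves, called ends, are labeled $x_1,\dots,x_n$, and the other edges are internal. Fix a reference orientation of all edges with all ends directed inward. For $\mathbf{x}\in V$, $F_\Gamma(\mathbf{x})$ is the affine space of real flows $f$ on the edges with $f=x_i$ on the $i$-th end and inflow equal to outflow at each internal vertex. $\mathcal{A}_\Gamma(\mathbf{x})$ is the arrangement in $F_\Gamma(\mathbf{x})$ of the hyperplanes $\{f(e)=0\}$, $e$ internal. Its chambers are called $F$-chambers; an $F$-chamber $A$ determines a directed graph $\Gamma_A$, in which an internal edge $e$ keeps its reference orientation if $f(e)>0$ on $A$ and is reversed if $f(e)<0$ on $A$. $\mathrm{Ch}(\mathcal{A}_\Gamma(\mathbf{x}))$ is the set of $F$-chambers. A set of $k$ of the hyperplanes meeting in codimension $k-\ell$ with $\ell\ge1$ is a nontransverse intersection; it is good if there is a set of $\ell$ vertices such that the $k$ edges are precisely the edges incident to these vertices, and bad otherwise (the case that $F_\Gamma(\mathbf{x})$ is contained in one of the hyperplanes counts as bad). Walls. For nonempty proper $J\subset\{1,\dots,n\}$, $W_J=\{\sum_{j\in J}x_j=0\}\subset V$; $H$-chambers are the connected components of $V\setminus\bigcup_J W_J$. Fix a wall $W_I$, two $H$-chambers $\mathfrak{c}_1,\mathfrak{c}_2$ adjacent across $W_I$ with $\sum_{i\in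 I}x_i<0$ on $\mathfrak{c}_1$ and $\sum_{i\in I}x_i>0$ on $\mathfrak{c}_2$, points $\mathbf{x}_1\in\mathfrak{c}_1$, $\mathbf{x}_2\in\mathfrak{c}_2$, and an $\mathbf{x}$-graph $\Gamma$ such that $\mathcal{A}_\Gamma(\mathbf{x})$ has a bad nontransverse intersection for a point $\mathbf{x}$ on the wall. Sinks and sources. These are meant after reversing the orientation of the out-ends (the ends with $x_i<0$; ends are otherwise directed inward), and leaves are not considered sinks or sources: an internal vertex is a sink (source) if all incident edges point toward (away from) it. Cuts. For a directed graph and a set $E'$ of edges, the quotient by $E'$ is the directed graph obtained by contracting all edges of $E'$. $\mathrm{Cuts}_I(\Gamma_A)$ is the set consisting of the empty set (the empty cut) and all subsets $C$ of the edges of $\Gamma_A$ such that: (1) $\Gamma_A\setminus C$ is disconnected; (2) the ends of $\Gamma_A$ lie on precisely two components of $\Gamma_A\setminus C$, one containing all ends in $I$, the other all ends in $I^c$; (3) the directed graph $\Gamma_A/C^c$ (all edges not in $C$ contracted) is acyclic and has the vertex of the component containing $I$ as an initial element and that of the component containing $I^c$ as a final element. It is a poset under inclusion, ranked by $\mathrm{rk}(C)=$ (number of connected components of $\Gamma\setminus C$) $-1$. The cuttable edges are those belonging to some element of $\mathrm{Cuts}_I(\Gamma_A)$. Gauss–Manin connection. A cone is given by prescribed orientations of a set of internal edges whose hyperplanes have nonempty common intersection in $F_\Gamma(\mathbf{x})$ for all $\mathbf{x}$; for such a partial orientation $\mathcal{P}$, $\mathcal{K}_{\mathcal{P}}(\mathfrak{c})\in\mathbb{R}[\mathrm{Ch}(\mathcal{A}_\Gamma(\mathfrak{c}))]$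 is the sum of all $F$-chambers in the cone, i.e. those whose orientation agrees with $\mathcal{P}$. Cones generate, and $\nabla_{\Gamma,12}:\mathbb{R}[\mathrm{Ch}(\mathcal{A}_\Gamma(\mathbf{x}_1))]\to\mathbb{R}[\mathrm{Ch}(\mathcal{A}_\Gamma(\mathbf{x}_2))]$ is the linear map with $\nabla_{\Gamma,12}\mathcal{K}_{\mathcal{P}}(\mathfrak{c}_1)=\mathcal{K}_{\mathcal{P}}(\mathfrak{c}_2)$ for all cones; on the span of the bounded chambers, identified with the relative homology $H_g(F_\Gamma(\mathbf{x})\otimes\mathbb{C},\mathcal{A}^{\mathbb{C}}_\Gamma(\mathbf{x}))$ of the complexified arrangement, it is parallel transport for the (trivial) Gauss–Manin connection over the complement of the complexified walls. $\nabla^*_{\Gamma,12}$ is its adjoint for the inner products in which the $F$-chambers are orthonormal. In the formula for $\nabla^*_{\Gamma,12}(A)$, terms for which $\Gamma_{A,E}$ does not correspond to an $F$-chamber of $\mathcal{A}_\Gamma(\mathbf{x}_1)$ are omitted.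
   Formalization: In the last claim, ''corresponds to an F-chamber in A_Γ(x_2) other than A'' is taken with the added condition that Γ_{A,E} corresponds to no F-chamber in A_Γ(x_1), as the claim fails otherwise; out-ends of Γ_{A,E} are determined by the signs of x_1. *)

(* Defs.v *)
From HB Require Import structures.
From mathcomp Require Import all_boot all_order all_algebra.
From mathcomp Require Import all_classical all_reals all_analysis.

Set Implicit Arguments.
Unset Strict Implicit.
Unset Printing Implicit Defensive.

Import Order.TTheory GRing.Theory Num.Theory.
Import numFieldNormedType.Exports.

Local Open Scope classical_set_scope.
Local Open Scope ring_scope.

(* Two vertices joined by an edge of K, regardless of its direction. *)
Definition adjacent_in (p m : nat) (src tgt : 'I_m -> 'I_p) (K : {set 'I_m}) :
    rel 'I_p :=
  fun u v => [exists e in K, ((src e == u) && (tgt e == v))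
                          || ((src e == v) && (tgt e == u))].

(* The leaves are left implicit: the i-th end joins the i-th leaf to the
   internal vertex att i and points towards att i.  Vertices and edges below are
   the internal ones; multiple edges and loops are allowed, a loop counting twice
   in the valence.  The n leaves and n ends cancel in the Euler characteristic,
   whence the form of the genus condition. *)
Record xgraph (n g : nat) := XGraph {
  nvert : nat;
  nedge : nat;
  src : 'I_nedge -> 'I_nvert;
  tgt : 'I_nedge -> 'I_nvert;
  att : 'I_n -> 'I_nvert;
  xgraph_trivalent : forall v : 'I_nvert,
    (#|[set e | src e == v]%SET| + #|[set e | tgt e == v]%SET|
       + #|[set i | att i == v]%SET| = 3)%N;
  xgraph_connected :
    n_comp (adjacent_in src tgt [set: 'I_nedge]%SET) predT = 1%N;
  xgraph_genus : (nedge + 1 = nvert + g)%N }.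

Section Walls.
Variables (R : realType) (n : nat).

Definition Vspace : set 'rV[R]_n := [set x | \sum_i x 0 i = 0].

Definition wall (J : {set 'I_n}) : set 'rV[R]_n :=
  Vspace `&` [set x | \sum_(j in J) x 0 j = 0].

Definition wall_index (J : {set 'I_n}) : bool :=
  (J != finset.set0) && (J != [set: 'I_n]%SET).

Definition off_walls : set 'rV[R]_n :=
  Vspace `\` \bigcup_(J in [set J | wall_index J]) wall J.

Definition H_chambers : set (set 'rV[R]_n) :=
  [set c | exists2 x, off_walls x & c = connected_component off_walls x].

(* The closures share a nonempty relatively open piece of the wall. *)
Definition adjacent_across (I : {set 'I_n}) (c1 c2 : set 'rV[R]_n) : Prop :=
  exists U : set 'rV[R]_n,
    [/\ open U, U `&` wall I !=set0 &
        U `&` wall I `<=` closure c1 `&` closure c2].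

End Walls.

(* S is an affine subspace of dimension d. *)
Definition affine_dim (R : realType) (m : nat) (S : set 'rV[R]_m) (d : nat) :
    Prop :=
  exists (p : 'rV[R]_m) (D : 'M[R]_(d, m)),
    row_free D /\ S = [set p + u *m D | u in [set: 'rV[R]_d]].

Section Flows.
Variables (R : realType) (n g : nat) (G : xgraph n g).
Implicit Types (x : 'rV[R]_n) (f : 'rV[R]_(nedge G)) (K : {set 'I_(nedge G)}).

(* A flow is recorded by its values on the internal edges; its value on the i-th
   end is x 0 i. *)
Definition flows x : set 'rV[R]_(nedge G) :=
  [set f | forall v : 'I_(nvert G),
     \sum_(e | tgt e == v) f 0 e + \sum_(i | att G i == v) x 0 i =
     \sum_(e | src e == v) f 0 e].

Definition hyperplane (e : 'I_(nedge G)) : set 'rV[R]_(nedge G) :=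
  [set f | f 0 e = 0].

Definition flat x K : set 'rV[R]_(nedge G) :=
  flows x `&` \bigcap_(e in [set e | e \in K]) hyperplane e.

Definition arr_complement x : set 'rV[R]_(nedge G) :=
  flows x `\` \bigcup_(e in [set: 'I_(nedge G)]) hyperplane e.

Definition F_chambers x : set (set 'rV[R]_(nedge G)) :=
  [set A | exists2 f, arr_complement x f
                    & A = connected_component (arr_complement x) f].

(* Hyperplanes are indexed by edges, so two edges with the same hyperplane
   count as two. *)
Definition nontransverse x K (l : nat) : Prop :=
  (0 < l)%N /\
  exists d d' : nat,
    [/\ affine_dim (flows x) d, affine_dim (flat x K) d' &
        (d' + #|K| = d + l)%N].

(* The edges incident to S are the internal edges K only: no end is attached
   to S. *)
Definition good_set K (l : nat) : Prop :=
  exists S : {set 'I_(nvert G)},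
    [/\ #|S| = l, forall i, att G i \notin S &
        K = [set e | (src e \in S) || (tgt e \in S)]%SET].

Definition bad_nontransverse x : Prop :=
  (exists e, flows x `<=` hyperplane e) \/
  (exists K l, nontransverse x K l /\ ~ good_set K l).

End Flows.

Arguments F_chambers {R n g} G x _.

Section Orientations.
Variables (n g : nat) (G : xgraph n g).

(* A directed x-graph: true means that the edge keeps its reference
   orientation. *)
Definition orientation := {ffun 'I_(nedge G) -> bool}.

Implicit Types (o : orientation) (C E : {set 'I_(nedge G)}).

Definition start o e : 'I_(nvert G) := if o e then src e else tgt e.
Definition stop o e : 'I_(nvert G) := if o e then tgt e else src e.

Definition reverse o E : orientation := [ffun e => o e (+) (e \in E)].

Definition joined C : rel 'I_(nvert G) :=
  adjacent_in (@src n g G) (@tgt n g G) (~: C)%SET.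

Definition component C (v : 'I_(nvert G)) : 'I_(nvert G) :=
  fingraph.root (joined C) v.

(* Arcs of the quotient by the complement of C; the vertices of the quotient
   are the components after removal of C, named by their roots. *)
Definition quotient_arc o C : rel 'I_(nvert G) :=
  fun a b => [exists e in C, (component C (start o e) == a)
                          && (component C (stop o e) == b)].

Definition is_cut (I : {set 'I_n}) o C : Prop :=
  [/\ (1 < n_comp (joined C) predT)%N,
      forall i j, connect (joined C) (att G i) (att G j)
                  = ((i \in I) == (j \in I)),
      forall s, cycle (quotient_arc o C) s -> s = [::],
      forall i v, i \in I ->
        connect (quotient_arc o C) (component C (att G i)) (component C v) &
      forall i v, i \notin I ->
        connect (quotient_arc o C) (component C v) (component C (att G i))].

Definition Cuts (I : {set 'I_n}) o : {set {set 'I_(nedge G)}} :=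
  [set C | (C == finset.set0) || `[< is_cut I o C >]]%SET.

Definition rk C : nat := (n_comp (joined C) predT).-1.

Definition cuttable (I : {set 'I_n}) o : {set 'I_(nedge G)} :=
  (\bigcup_(C in Cuts I o) C)%SET.

(* The i-th end points outward when x 0 i < 0, and inward otherwise. *)
Definition is_sink (R : realType) (x : 'rV[R]_n) o (v : 'I_(nvert G)) : Prop :=
  (forall e, start o e != v) /\ (forall i, att G i = v -> 0 <= x 0 i).

Definition is_source (R : realType) (x : 'rV[R]_n) o (v : 'I_(nvert G)) :
    Prop :=
  (forall e, stop o e != v) /\ (forall i, att G i = v -> x 0 i < 0).

Definition has_sink_or_source (R : realType) (x : 'rV[R]_n) o : Prop :=
  exists v, is_sink x o v \/ is_source x o v.

End Orientations.

Section GaussManin.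
Variables (R : realType) (n g : nat) (G : xgraph n g).

(* The directed graph of an F-chamber A; every f 0 e has constant sign on A. *)
Definition directed (A : set 'rV[R]_(nedge G)) : orientation G :=
  [ffun e => `[< forall f, A f -> 0 < f 0 e >]].

(* R[Ch]: there are finitely many F-chambers, so vectors are all functions. *)
Notation RCh x := (set_type (@F_chambers R n g G x) -> R^o).

Definition chamber_basis (x : 'rV[R]_n) (A : F_chambers G x) : RCh x :=
  fun B => (B == A)%:R.

(* The basis vector of the F-chamber with directed graph o, or 0 if there is no
   such F-chamber. *)
Definition chamber_of (x : 'rV[R]_n) (o : orientation G) : RCh x :=
  if pselect (exists B : F_chambers G x, directed (val B) = o) is left exB
  then chamber_basis (projT1 (cid exB)) else 0.

Definition cone_edges (S : {set 'I_(nedge G)}) : Prop :=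
  forall x : 'rV[R]_n, Vspace x -> flat x S !=set0.

(* The partial orientation is the restriction of o to S. *)
Definition cone (S : {set 'I_(nedge G)}) (o : orientation G) (x : 'rV[R]_n) :
    RCh x :=
  fun A => [forall e in S, directed (val A) e == o e]%:R.

Arguments cone S o x _ : clear implicits.

(* Cones generate, so this determines nabla. *)
Definition is_gauss_manin (x1 x2 : 'rV[R]_n)
    (nabla : {linear RCh x1 -> RCh x2}) : Prop :=
  forall (S : {set 'I_(nedge G)}) (o : orientation G),
    cone_edges S -> nabla (cone S o x1) = cone S o x2.

Definition dotCh (x : 'rV[R]_n) (u v : RCh x) : R :=
  \sum_(A \in [set: F_chambers G x]) u A * v A.

Definition is_adjoint (x1 x2 : 'rV[R]_n) (nabla : {linear RCh x1 -> RCh x2})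
    (nablaT : {linear RCh x2 -> RCh x1}) : Prop :=
  forall u v, dotCh (nabla u) v = dotCh u (nablaT v).

End GaussManin.

Arguments chamber_of {R n g G} x o _.
Arguments cone {R n g G} S o x _.

Notation RCh G x := (set_type (F_chambers G x) -> GRing.regular _).

(* Main.v *)
From HB Require Import structures.
From mathcomp Require Import all_classical all_reals all_analysis.
From mathcomp Require Import all_boot all_order all_algebra.
From mathcomp Require Import ring lra.
Require Import Defs.

Set Implicit Arguments.
Unset Strict Implicit.
Unset Printing Implicit Defensive.

Import Order.TTheory GRing.Theory Num.Theory.
Import numFieldNormedType.Exports.

Local Open Scope ring_scope.

(* Let o be the directed graph of A. For a set E of edges put
   s(E) = sum of (-1)^rk(C) over the cuts C containing E.
   A nonempty cut C with the ends of I and of its complement contracted is an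
   acyclic network, and (-1)^rk(C) is its signed domination: the alternating sum,
   over the subsets D of C, of the indicator that the complement of I is joined to
   I by reversed edges of D. This alternating sum vanishes for all C that are not
   cuts. The indicator of having a path is a valuation in the state of each edge
   (forward, backward, both, none), so summing over C gives
     s(E) = sum over D in E of (-1)^|D| [I^c reaches I by the edges outside E
                                         and the reversed edges of D].
   If the reversal of o along E carries no positive flow with boundary values x1,
   Hoffman's theorem provides a vertex set without incoming edges and with
   nonpositive supply, and then s(E) = 0: either toggling some reversed edge
   changes no path, or there is no path, or no cut contains E by uncrossing.
   Hence in the formula the restriction to chambers of x1 may be dropped, and the
   pairing with a cone on the edges S is an alternating sum over all subsets of
   the cuts, in which only the empty cut survives because no nonempty cut lies
   in S. *)

(** * Signed sums and signed domination *)

Section SignedSums.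
Variable T : finType.
Implicit Types (X D : {set T}) (F : {set T} -> int).

Lemma sum_powersetD1 e X F : e \in X ->
  \sum_(D in powerset X) F D =
  \sum_(D in powerset (X :\ e)) (F D + F (e |: D)).
Proof.
move=> eX; rewrite (bigID (fun D => e \in D)) /= addrC big_split /=.
congr (_ + _).
  by apply: eq_bigl => D; rewrite !powersetE subsetD1.
rewrite (reindex_onto (fun D => e |: D) (fun D => D :\ e)) /=; last first.
  by move=> D /andP[_ eD]; rewrite setD1K.
apply: eq_bigl => D; rewrite !powersetE setU11 andbT subsetD1 subUset sub1set eX /=.
apply/andP/andP=> [[DX /eqP eqD]|[DX eD]]; first by rewrite DX -eqD setD11.
by rewrite DX setU1K.
Qed.

Lemma cardsU1_sign e D : e \notin D -> (-1) ^+ #|e |: D| = - (-1) ^+ #|D| :> int.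
Proof. by move=> eD; rewrite cardsU1 eD add1n exprS mulN1r. Qed.

Definition signed_sum X (b : {set T} -> bool) : int :=
  \sum_(D in powerset X) (-1) ^+ #|D| * (b D)%:R.

Lemma eq_signed_sum X b b' : (forall D, D \subset X -> b D = b' D) ->
  signed_sum X b = signed_sum X b'.
Proof. by move=> eq_b; apply: eq_bigr => D; rewrite powersetE => /eq_b ->. Qed.

Lemma signed_sumD1 e X b : e \in X ->
  signed_sum X b = signed_sum (X :\ e) b - signed_sum (X :\ e) (fun D => b (e |: D)).
Proof.
move=> eX; rewrite /signed_sum (sum_powersetD1 _ eX) big_split -sumrN /=.
congr (_ + _); apply: eq_bigr => D; rewrite powersetE subsetD1 => /andP[_ eD].
by rewrite cardsU1_sign // mulNr.
Qed.

(** The subsets [D] and [e |: D] cancel in pairs. *)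
Lemma signed_sum_irrelevant e X b : e \in X ->
  (forall D, D \subset X -> e \notin D -> b (e |: D) = b D) -> signed_sum X b = 0.
Proof.
move=> eX eb; rewrite (signed_sumD1 _ eX) (@eq_signed_sum _ b (fun D => b (e |: D))).
  by rewrite subrr.
by move=> D; rewrite subsetD1 => /andP[DX eD]; rewrite eb.
Qed.

Lemma signed_sum0 b : signed_sum set0 b = (b set0)%:R.
Proof. by rewrite /signed_sum powerset0 big_set1 cards0 mul1r. Qed.

(** Isolates the coefficient of each [E], namely the weight of all [C] above it, so that the
    vanishing of this weight can be applied term by term. *)
Lemma exchange_signed_sum (P : {set {set T}}) (w : {set T} -> int) b :
  \sum_(C in P) w C * signed_sum C b =
  \sum_(E : {set T}) (-1) ^+ #|E| * (b E)%:R * \sum_(C in P | E \subset C) w C.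
Proof.
under eq_bigr => C _ do rewrite /signed_sum big_distrr /=.
rewrite (exchange_big_dep predT) //=; apply: eq_bigr => E _; rewrite big_distrr /=.
apply: eq_big => [C|C _]; first by rewrite powersetE.
by rewrite mulrC.
Qed.

End SignedSums.

(** * Paths in finite digraphs and the effect of adding an arc *)

Section Reachability.
Variable V : finType.
Implicit Types (S T : {set V}) (r : rel V).

Lemma eq_connect_add r r' u w :
    (forall a b, r' a b = r a b || ((a == u) && (b == w))) ->
  forall x y, connect r' x y = connect r x y || (connect r x u && connect r w y).
Proof.
move=> r'E x y; apply/idP/idP.
  case/connectP=> p; elim: p x => [|z p IHp] x /=.
    by move=> _ ->; rewrite connect0.
  rewrite r'E => /andP[rxz pzp] y_last; have := IHp z pzp y_last.
  case/orP: rxz => [rxz|/andP[/eqP-> /eqP->]].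
    case/orP=> [zy|/andP[zu ->]]; first by rewrite (connect_trans (connect1 rxz) zy).
    by rewrite (connect_trans (connect1 rxz) zu) orbT.
  by rewrite connect0 => /orP[->|/andP[_ ->]]; rewrite orbT.
have rr' : subrel (connect r) (connect r').
  by apply: connect_sub => a b rab; rewrite connect1 // r'E rab.
case/orP=> [/rr'//|/andP[/rr' xu /rr' wy]].
by rewrite (connect_trans xu) // (connect_trans _ wy) // connect1 // r'E !eqxx orbT.
Qed.

Definition from S r u := [exists a in S, connect r a u].
Definition into T r u := [exists b in T, connect r u b].
Definition reach S T r := [exists a in S, into T r a].

Lemma fromP S r u : reflect (exists2 a, a \in S & connect r a u) (from S r u).
Proof. by apply: (iffP exists_inP). Qed.

Lemma intoP T r u : reflect (exists2 b, b \in T & connect r u b) (into T r u).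
Proof. by apply: (iffP exists_inP). Qed.

Lemma reachP S T r :
  reflect (exists a b, [/\ a \in S, b \in T & connect r a b]) (reach S T r).
Proof.
apply: (iffP exists_inP) => [[a aS /intoP[b bT ab]]|[a [b [aS bT ab]]]].
  by exists a, b.
by exists a => //; apply/intoP; exists b.
Qed.

Lemma reach_from_into S T r u : from S r u -> into T r u -> reach S T r.
Proof.
move=> /fromP[a aS au] /intoP[b bT ub]; apply/reachP; exists a, b; split => //.
exact: connect_trans ub.
Qed.

Lemma from_mem S r u : u \in S -> from S r u.
Proof. by move=> uS; apply/fromP; exists u. Qed.

Lemma into_mem T r u : u \in T -> into T r u.
Proof. by move=> uT; apply/intoP; exists u. Qed.

Section AddArc.
Variables (r r' : rel V) (u w : V).
Hypothesis r'E : forall a b, r' a b = r a b || ((a == u) && (b == w)).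

Lemma from_add S v : from S r' v = from S r v || (from S r u && connect r w v).
Proof.
apply/fromP/orP=> [[a aS]|].
  rewrite (eq_connect_add r'E) => /orP[av|/andP[au wv]].
    by left; apply/fromP; exists a.
  by right; rewrite wv andbT; apply/fromP; exists a.
case=> [/fromP[a aS av]|/andP[/fromP[a aS au] wv]]; exists a => //.
  by rewrite (eq_connect_add r'E) av.
by rewrite (eq_connect_add r'E) au wv orbT.
Qed.

Lemma into_add T v : into T r' v = into T r v || (connect r v u && into T r w).
Proof.
apply/intoP/orP=> [[b bT]|].
  rewrite (eq_connect_add r'E) => /orP[vb|/andP[vu wb]].
    by left; apply/intoP; exists b.
  by right; rewrite vu; apply/intoP; exists b.
case=> [/intoP[b bT vb]|/andP[vu /intoP[b bT wb]]]; exists b => //.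
  by rewrite (eq_connect_add r'E) vb.
by rewrite (eq_connect_add r'E) vu wb orbT.
Qed.

Lemma reach_add S T : reach S T r' = reach S T r || (from S r u && into T r w).
Proof.
apply/exists_inP/orP=> [[a aS]|].
  rewrite into_add => /orP[ai|/andP[au wi]].
    by left; apply/exists_inP; exists a.
  by right; rewrite wi andbT; apply/fromP; exists a.
case=> [/exists_inP[a aS ai]|/andP[/fromP[a aS au] wi]]; exists a => //.
  by rewrite into_add ai.
by rewrite into_add au wi orbT.
Qed.

End AddArc.

(* A path from [S] to [T] uses at most one direction of an edge, and the two
   directions cannot both be useful unless the edge can be avoided. *)
Lemma reach_valuation S T r ra rb rab u w :
    (forall a b, ra a b = r a b || ((a == u) && (b == w))) ->
    (forall a b, rb a b = r a b || ((a == w) && (b == u))) ->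
    (forall a b, rab a b = ra a b || ((a == w) && (b == u))) ->
  (reach S T ra)%:R = (reach S T r)%:R - (reach S T rb)%:R + (reach S T rab)%:R :> int.
Proof.
move=> raE rbE rabE.
rewrite (reach_add rabE) (reach_add rbE) (reach_add raE) (from_add raE) (into_add raE).
rewrite !connect0 andbT /=.
have := @reach_from_into S T r u; have := @reach_from_into S T r w.
by case: (reach _ _ _) (from _ _ u) (from _ _ w) (into _ _ u) (into _ _ w) => -[] [] [] [] //= H H';
  rewrite ?subrr ?add0r ?subr0 //; (try by have := H isT isT); by have := H' isT isT.
Qed.

Lemma acyclic_min r S : (forall s, cycle r s -> s = [::]) -> S != set0 ->
  exists2 v, v \in S & forall u, u \in S -> ~~ r u v.
Proof.
move=> acyc /set0Pn[v0 v0S].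
(* [v] has the fewest ancestors in [S]. An arc from [u] in [S] to [v] would give [u] strictly fewer,
   since acyclicity keeps [v] from being an ancestor of [u]. *)
case: (arg_minnP (fun v => #|[pred u | connect r u v]|) v0S) => v vS vmin.
exists v => // u uS; apply/negP => ruv.
have := vmin _ uS; apply/negP; rewrite -ltnNge; apply/proper_card/properP.
split; first by apply/subsetP=> z; rewrite !inE => /connect_trans; apply; apply: connect1.
exists v; rewrite !inE ?connect0 //; apply/connectP=> -[p rp u_last].
by have := acyc (v :: p); rewrite /= rcons_path rp -u_last ruv => /(_ isT).
Qed.

(** Otherwise a minimal vertex of [S] not reached from [v0] would have an in-neighbour in [S], which
    is reached by minimality. *)
Lemma acyclic_from r S v0 : (forall s, cycle r s -> s = [::]) ->
    (forall v, v \in S -> v != v0 -> exists2 u, u \in S & r u v) ->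
  forall v, v \in S -> connect r v0 v.
Proof.
move=> acyc in_arc v vS; apply: contraT => v0v.
have /(acyclic_min acyc)[w] : [set u in S | ~~ connect r v0 u] != set0.
  by apply/set0Pn; exists v; rewrite inE vS.
rewrite inE => /andP[wS v0w] wmin.
have [//||u uS ruw] := in_arc w; first by apply: contraNneq v0w => ->; rewrite connect0.
have := contraTN (wmin u) ruw; rewrite inE uS negbK => v0u.
by rewrite (connect_trans v0u (connect1 ruw)) in v0w.
Qed.

Lemma acyclic_no_back r a b : (forall s, cycle r s -> s = [::]) ->
  connect r a b -> ~~ r b a.
Proof.
move=> acyc /connectP[p rp ->]; apply/negP=> rba.
by have := acyc (a :: p); rewrite /= rcons_path rp rba => /(_ isT).
Qed.

End Reachability.

(** * Signed domination of a network *)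

Section SignedDomination.
Variables (V Ed : finType) (tl hd : Ed -> V).
Implicit Types (S T : {set V}) (X D : {set Ed}).

Definition arc D : rel V := fun a b => [exists e in D, (tl e == a) && (hd e == b)].

Lemma arcP D a b : reflect (exists e, [/\ e \in D, tl e = a & hd e = b]) (arc D a b).
Proof.
apply: (iffP exists_inP) => [[e eD /andP[/eqP ? /eqP ?]]|[e [eD ? ?]]]; exists e => //.
by apply/andP; split; apply/eqP.
Qed.

Lemma arcU1 e D a b : arc (e |: D) a b = arc D a b || ((a == tl e) && (b == hd e)).
Proof.
apply/arcP/orP=> [[e' []]|[/arcP[e' [e'D <- <-]]|/andP[/eqP-> /eqP->]]].
- rewrite !inE => /orP[/eqP->|e'D] <- <-; first by right; rewrite !eqxx.
  by left; apply/arcP; exists e'.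
- by exists e'; rewrite !inE e'D orbT.
- by exists e; rewrite !inE eqxx.
Qed.

Lemma arcS D D' : D \subset D' -> subrel (arc D) (arc D').
Proof. by move=> /subsetP sD a b /arcP[e [/sD eD' ? ?]]; apply/arcP; exists e. Qed.

Definition domination S T X := signed_sum X (fun D => reach S T (arc D)).

Lemma domination_head0 S T X e : e \in X -> hd e \in S -> domination S T X = 0.
Proof.
move=> eX heS; apply: (signed_sum_irrelevant eX) => D _ _.
rewrite (reach_add (arcU1 e D)); apply/orb_idr => /andP[_].
exact/reach_from_into/from_mem.
Qed.

Lemma domination_tail0 S T X e : e \in X -> tl e \in T -> domination S T X = 0.
Proof.
move=> eX teT; apply: (signed_sum_irrelevant eX) => D _ _.
rewrite (reach_add (arcU1 e D)); apply/orb_idr => /andP[fS _].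
by apply: reach_from_into fS _; apply: into_mem.
Qed.

(** Deletion and contraction: an arc leaving the source set acts by adding its head to the
    sources. *)
Lemma dominationD1 S T X e : e \in X -> tl e \in S ->
  domination S T X = domination S T (X :\ e) - domination (hd e |: S) T (X :\ e).
Proof.
move=> eX teS; rewrite /domination (signed_sumD1 _ eX); congr (_ - _).
apply: eq_signed_sum => D _; rewrite (reach_add (arcU1 e D)) from_mem //=.
apply/orP/exists_inP=> [[/exists_inP[a aS ai]|hi]|[a]].
- by exists a; rewrite // inE aS orbT.
- by exists (hd e); rewrite // setU11.
rewrite !inE => /orP[/eqP->|aS ai]; [by right | left].
by apply/exists_inP; exists a.
Qed.

Lemma path_arcD1 e X a p : tl e != a -> {in p, forall v, v != tl e} ->
  path (arc X) a p -> path (arc (X :\ e)) a p.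
Proof.
elim: p a => //= b p IHp a ea ep /andP[/arcP[e' [e'X e'a e'b]] pbp].
rewrite IHp //; last 2 first.
- by rewrite eq_sym ep // mem_head.
- by move=> v vp; rewrite ep // inE vp orbT.
rewrite andbT; apply/arcP; exists e'; split => //; rewrite !inE e'X andbT.
by apply: contraNneq ea => <-; rewrite e'a.
Qed.

(** Induction by deletion and contraction of an arc leaving [S]. If no arc enters [S], the vertices
    of the cycle, being heads of arcs, lie outside [S]; so the chosen arc is off the cycle, which
    survives in both terms. If an arc enters [S], or if none leaves it, that arc or any arc is
    irrelevant. *)
Lemma domination_cyclic S T X s : s != [::] -> cycle (arc X) s -> domination S T X = 0.
Proof.
move=> s0; have [m] := ubnP #|X|; elim: m S X => // m IHm S X /ltnSE leXm cyc.
have [/existsP[e /andP[eX heS]]|/existsPn noh] :=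
    boolP [exists e, (e \in X) && (hd e \in S)].
  exact: domination_head0 eX heS.
have [/existsP[e /andP[eX teS]]|/existsPn not] :=
    boolP [exists e, (e \in X) && (tl e \in S)]; last first.
  have [e eX] : exists e, e \in X.
    case: s s0 cyc {IHm} => // a s _ /=; rewrite rcons_path => /andP[_ /arcP[e [eX _ _]]].
    by exists e.
  apply: (signed_sum_irrelevant eX) => D DX _.
  rewrite (reach_add (arcU1 e D)); apply/orb_idr => /andP[/fromP[a aS]].
  case/connectP=> -[|b p] /=.
    by move=> _ ea; have := not e; rewrite eX ea aS.
  case/andP=> /arcP[e' [/(subsetP DX) e'X ta _]] _ _.
  by have := not e'; rewrite e'X ta aS.
have s_notin v : v \in s -> v \notin S.
  move=> vs; have := prev_cycle cyc vs => /arcP[e' [e'X _ <-]].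
  by have := noh e'; rewrite e'X.
have cyc' : cycle (arc (X :\ e)) s.
  case: s {s0 IHm} cyc s_notin => // a s /= cyc s_notin; apply: path_arcD1 => //.
    by apply: contraNneq (s_notin a (mem_head _ _)) => <-.
  move=> v; rewrite mem_rcons => /s_notin; by apply: contraNneq => ->.
have ltXe : (#|X :\ e| < m)%N by rewrite (leq_trans _ leXm) // [in leqRHS](cardsD1 e) eX.
by rewrite (dominationD1 _ eX teS) !IHm ?subrr.
Qed.

(** Deletion and contraction of an arc [e] leaving [S]. If another arc has the same head, the
    contraction vanishes and the deletion keeps the hypotheses. Otherwise the deletion vanishes and
    the contraction has one vertex fewer outside [S], whence one sign per vertex. *)
Lemma domination_acyclic S t X : (forall s, cycle (arc X) s -> s = [::]) ->
    {in X, forall e, hd e \notin S} ->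
    (forall v, v \notin S -> exists2 e, e \in X & hd e = v) ->
    (forall v, v \notin S -> v != t -> exists2 e, e \in X & tl e = v) ->
  domination S [set t] X = (-1) ^+ #|~: S|.
Proof.
have [m] := ubnP #|X|; elim: m S X => // m IHm S X /ltnSE leXm acyc hX inX outX.
have [/existsP[e /andP[eX teS]]|/existsPn not] :=
    boolP [exists e, (e \in X) && (tl e \in S)]; last first.
  (* A minimal vertex outside [S] would have an incoming arc, whose tail is excluded from [S]
     because no arc leaves it, and from the complement by minimality. *)
  have S_T : S = [set: V].
    apply/setP=> v; rewrite inE; apply: contraT => vS.
    have [|w] := acyclic_min acyc (S := ~: S).
      by apply/set0Pn; exists v; rewrite inE.
    rewrite inE => /inX[e eX <-] wmin.
    have := wmin (tl e); rewrite inE; have := not e; rewrite eX /= => -> /(_ isT).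
    by case/arcP; exists e.
  have X0 : X = set0 by apply/setP=> e; rewrite inE; apply/negP=> /hX; rewrite S_T inE.
  rewrite S_T X0 setCT cards0 /domination signed_sum0 (_ : reach _ _ _ = true) //.
  by apply/reachP; exists t, t; rewrite !inE connect0.
have ltXe : (#|X :\ e| < m)%N by rewrite (leq_trans _ leXm) // [in leqRHS](cardsD1 e) eX.
have acyc' s : cycle (arc (X :\ e)) s -> s = [::].
  move=> cs; apply: acyc; case: s cs => //= a s; apply: sub_path.
  exact: arcS (subsetDl _ _).
have heS := hX _ eX; rewrite (dominationD1 _ eX teS).
have outX' v : v \notin S -> v != t -> exists2 e', e' \in X :\ e & tl e' = v.
  move=> vS vt; have [e' e'X e'v] := outX v vS vt; exists e' => //.
  by rewrite !inE e'X andbT; apply: contraNneq vS => ee; rewrite -e'v ee.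
have [/existsP[e' /andP[e'X /eqP he']]|/existsPn noh] :=
    boolP [exists e', (e' \in X :\ e) && (hd e' == hd e)].
  have heU : hd e' \in hd e |: S by rewrite he' setU11.
  rewrite (domination_head0 _ e'X heU) subr0.
  apply: IHm => // [f /setD1P[_ /hX]//|v vS].
  have [f fX fv] := inX v vS; have [fe|fe] := eqVneq f e.
    by exists e'; rewrite // he' -fe.
  by exists f; rewrite // !inE fe.
(* Without [e] no arc enters its head. If the head is [t], no path arrives; otherwise an arc out of
   the head is irrelevant. *)
have -> : domination S [set t] (X :\ e) = 0.
  have noin D x : D \subset X :\ e -> connect (arc D) x (hd e) -> x = hd e.
    move=> DX /connectP[p]; elim/last_ind: p => [_ -> //|p y _].
    rewrite last_rcons rcons_path => /andP[_ /arcP[f [/(subsetP DX) fX _ fy]]] ey.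
    by have := noh f; rewrite fX fy ey eqxx.
  have [het|het] := eqVneq (hd e) t.
    rewrite /domination /signed_sum big1 // => D; rewrite powersetE => DX.
    case: reachP => [[a [b [aS]]]|]; last by rewrite mulr0.
    by rewrite inE -het => /eqP-> /(noin _ _ DX) ah; rewrite -ah aS in heS.
  have [f fX fh] := outX' _ heS het.
  apply: (signed_sum_irrelevant fX) => D DX _.
  rewrite (reach_add (arcU1 f D)); apply/orb_idr => /andP[/fromP[a aS]].
  by rewrite fh => /(noin _ _ DX) ah; rewrite -ah aS in heS.
rewrite sub0r IHm //; last 3 first.
- move=> f fX; have := noh f; rewrite fX !inE negb_or /= => ->.
  by rewrite hX //; case/setD1P: fX.
- move=> v; rewrite !inE negb_or => /andP[ve vS].
  have [f fX fv] := inX v vS; exists f => //; rewrite !inE fX andbT.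
  by apply: contraNneq ve => <-; rewrite fv.
- by move=> v; rewrite !inE negb_or => /andP[_ vS]; apply: outX'.
have -> : ~: S = hd e |: ~: (hd e |: S).
  by apply/setP=> v; rewrite !inE; case: eqVneq => [->|].
by rewrite cardsU1_sign // !inE eqxx.
Qed.

End SignedDomination.

(** * Expansion of one-way edges into absent, backward and two-way edges *)

Section EdgeExpansion.
Variables (V Ed : finType) (tl hd : Ed -> V) (S T : {set V}).
Implicit Types (P Q D E N C : {set Ed}).

(** Edges of [P] are run forward and those of [Q] backward. An edge in both is two-way, hence
    contracted as far as paths are concerned; an edge in neither is deleted. *)
Definition steps P Q : rel V := fun a b => arc tl hd P a b || arc hd tl Q a b.

(** On the left the edges of [N] are forward and those outside [E :|: N] two-way. By the valuation
    property, forward equals none minus backward plus two-way: the first two terms move an edge of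
    [N] into [E], the last one moves it out of [E :|: N]. Induction distributes all of [N]. *)
Lemma edge_expansion E N : [disjoint E & N] ->
  signed_sum E (fun D => reach S T (steps (~: E) (D :|: ~: (E :|: N)))) =
  \sum_(C : {set Ed} | (E \subset C) && (C \subset E :|: N))
    signed_sum C (fun D => reach S T (steps (~: C) (D :|: ~: C))).
Proof.
have [m] := ubnP #|N|; elim: m E N => // m IHm E N /ltnSE leNm dEN.
have [->|/set0Pn[e eN]] := eqVneq N set0.
  rewrite setU0 (big_pred1 E) // => C; apply/andP/eqP=> [[EC CE]|->//].
  by apply/eqP; rewrite eqEsubset CE EC.
have eE : e \notin E by rewrite (disjointFl dEN eN).
have ltNe : (#|N :\ e| < m)%N by rewrite (leq_trans _ leNm) // [in leqRHS](cardsD1 e) eN.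
rewrite (bigID (fun C : {set Ed} => e \in C)) /=.
have UN : (e |: E) :|: (N :\ e) = E :|: N.
  by rewrite -setUA setUCA setD1K.
have EN : ~: (E :|: N :\ e) = e |: ~: (E :|: N).
  apply/setP=> f; rewrite !inE; case: eqVneq => [->|] //=; first by rewrite (negPf eE).
have cE : ~: E = e |: ~: (e |: E).
  by apply/setP=> f; rewrite !inE; case: eqVneq => [->|].
transitivity (signed_sum (e |: E) (fun D => reach S T
      (steps (~: (e |: E)) (D :|: ~: ((e |: E) :|: (N :\ e)))))
    + signed_sum E (fun D => reach S T (steps (~: E) (D :|: ~: (E :|: N :\ e))))).
  rewrite (signed_sumD1 _ (setU11 e E)) (setU1K eE) UN EN /signed_sum -sumrB -big_split /=.
  apply: eq_bigr => D; rewrite powersetE => DE; rewrite -mulrBr -mulrDr; congr (_ * _).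
  rewrite -[(e |: D) :|: _]setUA [D :|: (e |: _)]setUCA; set M := D :|: _.
  apply: (@reach_valuation _ _ _ _ _ _ _ (tl e) (hd e)) => a b.
  - by rewrite /steps cE arcU1 -!orbA; congr (_ || _); rewrite orbC.
  - by rewrite /steps arcU1 -!orbA.
  - by rewrite /steps arcU1 -!orbA.
rewrite !IHm //; last 2 first.
- by rewrite (disjointWr (subsetDl _ _) dEN).
- rewrite disjoints_subset subUset sub1set !inE eqxx /= -disjoints_subset.
  exact: disjointWr (subsetDl _ _) dEN.
congr (_ + _); apply: eq_bigl => C.
  by rewrite UN subUset sub1set -!andbA andbC -!andbA.
rewrite -andbA; congr (_ && _).
apply/idP/andP => [CEN|[CEN eC]].
  split; first by rewrite (subset_trans CEN) // setUS // subsetDl.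
  by apply: contra eE => /(subsetP CEN); rewrite !inE eqxx orbF.
apply/subsetP=> f fC; have := subsetP CEN f fC; rewrite !inE.
by have -> : f != e by apply: contraNneq eC => <-.
Qed.

Lemma edge_expansion_above E :
  \sum_(C : {set Ed} | E \subset C)
    signed_sum C (fun D => reach S T (steps (~: C) (D :|: ~: C))) =
  signed_sum E (fun D => reach S T (steps (~: E) D)).
Proof.
have := @edge_expansion E (~: E); rewrite disjoints_subset setCK subxx => /(_ isT).
rewrite setUCr setCT => EE.
under eq_bigl => C do rewrite -[E \subset C]andbT -(subsetT C).
by rewrite -EE; apply: eq_signed_sum => D _; rewrite setU0.
Qed.

End EdgeExpansion.

(** * Directed cuts *)

Section Cuts.
Variables (n g : nat) (G : xgraph n g) (I : {set 'I_n}).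
Implicit Types (o : orientation G) (C E D : {set 'I_(nedge G)}) (v : 'I_(nvert G)).

Lemma start_reverse o E e :
  start (reverse o E) e = if e \in E then stop o e else start o e.
Proof. by rewrite /start /stop ffunE; case: (o e); case: (e \in E). Qed.

Lemma stop_reverse o E e :
  stop (reverse o E) e = if e \in E then start o e else stop o e.
Proof. by rewrite /start /stop ffunE; case: (o e); case: (e \in E). Qed.

Lemma joinedP o C u v :
  reflect (exists2 e, e \notin C & (start o e = u /\ stop o e = v)
                                \/ (start o e = v /\ stop o e = u))
          (joined C u v).
Proof.
apply: (iffP exists_inP) => [[e eC se]|[e eC se]]; exists e; rewrite ?inE // in eC *.
  rewrite /start /stop; case: (o e); case/orP: se => /andP[/eqP<- /eqP<-]; auto.
move: se; rewrite /start /stop; case: (o e) => -[] [<- <-]; rewrite !eqxx ?orbT //.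
Qed.

Lemma joined_sym C : connect_sym (joined C).
Proof.
apply: sym_connect_sym => u v; apply: eq_existsb => e; congr (_ && _).
by rewrite orbC.
Qed.

Lemma componentP C u v : reflect (component C u = component C v) (connect (joined C) u v).
Proof. exact: fingraph.rootP (joined_sym C) _ _. Qed.

Lemma component_root C v : component C v \in fingraph.roots (joined C).
Proof. exact: fingraph.roots_root (joined_sym C) v. Qed.

Lemma component_id C v : v \in fingraph.roots (joined C) -> component C v = v.
Proof. by move/eqP. Qed.

Lemma component_edge o C e : e \notin C -> component C (start o e) = component C (stop o e).
Proof.
by move=> eC; apply/componentP/connect1/(joinedP o); exists e => //; left.
Qed.

(** Edges outside [C] are two-way, which amounts to contracting them. Edges of [D] are run backward,
    so [stop] gives the tail and [start] the head. *)
Lemma connect_contract o C D u v : D \subset C ->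
  connect (steps (start o) (stop o) (~: C) (D :|: ~: C)) u v =
  connect (arc (component C \o stop o) (component C \o start o) D)
          (component C u) (component C v).
Proof.
move=> DC; apply/idP/idP.
  case/connectP=> p; elim: p u => [|w p IHp] u /=; first by move=> _ ->; rewrite connect0.
  case/andP=> uw wp v_last; have {IHp wp v_last} wv := IHp w wp v_last.
  case/orP: uw => /arcP[e [+ <- ew]]; rewrite !inE.
    by move=> eC; rewrite (component_edge o eC) ew.
  case/orP=> [eD|eC]; last by rewrite -(component_edge o eC) ew.
  apply: connect_trans wv; apply: connect1; apply/arcP; exists e; split => //=.
  by rewrite ew.
have base : subrel (connect (joined C)) (connect (steps (start o) (stop o) (~: C) (D :|: ~: C))).
  apply: connect_sub => a b /(joinedP o)[e eC ab]; apply: connect1; apply/orP.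
  case: ab => -[<- <-]; [left|right]; apply/arcP; exists e; rewrite !inE ?eC ?orbT //.
case/connectP=> p; elim: p u => [|b p IHp] u /=.
  by move=> _ /componentP; rewrite joined_sym => /base.
case/andP=> /arcP[e [eD /= ae eb]]; rewrite -eb => bp v_last.
have stv := IHp (start o e) bp v_last.
have us : connect (joined C) u (stop o e) by apply/componentP.
apply: connect_trans (base _ _ us) (connect_trans (connect1 _) stv).
apply/orP; right; apply/arcP; exists e; rewrite !inE eD; split => //.
Qed.

(* The alternating sum over [E = C] of the edge expansion: the contribution of
   the potentials that are constant off [C] and increase strictly along [C]. *)
Definition cut_term o C : int :=
  signed_sum C (fun D => reach (att G @: ~: I) (att G @: I)
    (steps (start o) (stop o) (~: C) (D :|: ~: C))).

Lemma cut_term_domination o C :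
  cut_term o C = domination (component C \o stop o) (component C \o start o)
    (component C @: (att G @: ~: I)) (component C @: (att G @: I)) C.
Proof.
apply: eq_signed_sum => D DC; apply/reachP/reachP.
  move=> [u [v [uS vT uv]]]; exists (component C u), (component C v).
  by rewrite !imset_f // -connect_contract.
move=> [a [b [/imsetP[u uS ->] /imsetP[v vT ->]]]]; rewrite -connect_contract // => uv.
by exists u, v.
Qed.

Lemma connect_joined0 u v : connect (joined (set0 : {set 'I_(nedge G)})) u v.
Proof.
have := xgraph_connected G; rewrite -setC0 => n1.
have /card_le1_eqP r1 : (n_comp (joined (set0 : {set 'I_(nedge G)})) predT <= 1)%N.
  by rewrite [n_comp _ _]n1.
by apply/componentP/r1; rewrite !inE andbT; apply: component_root.
Qed.

Lemma rk_set0 : rk (set0 : {set 'I_(nedge G)}) = 0%N.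
Proof. by have := xgraph_connected G; rewrite -setC0 /rk => n1; rewrite [n_comp _ _]n1. Qed.

Hypothesis hI : wall_index I.

Lemma wall_index_in : exists i, i \in I.
Proof. by case/andP: hI => /set0Pn. Qed.

Lemma wall_index_notin : exists j, j \notin I.
Proof. by case/andP: hI => _; rewrite -subTset => /subsetPn[j _ jI]; exists j. Qed.

Lemma cut_term_set0 o : cut_term o set0 = 1.
Proof.
rewrite /cut_term signed_sum0; set b := reach _ _ _; suff -> : b by [].
have [[i iI] [j jI]] := (wall_index_in, wall_index_notin).
apply/reachP; exists (att G j), (att G i); rewrite !imset_f ?inE //; split => //.
rewrite (connect_contract o _ _ (sub0set _)).
by rewrite (elimT (componentP _ _ _) (connect_joined0 (att G j) (att G i))) connect0.
Qed.

Lemma quotient_arc_rev o C :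
  arc (component C \o stop o) (component C \o start o) C =2
  [rel a b | quotient_arc o C b a].
Proof. by move=> a b; apply: eq_existsb => e; congr (_ && _); rewrite andbC. Qed.

Lemma quotient_arcP o C a b :
  reflect (exists e, [/\ e \in C, component C (start o e) = a & component C (stop o e) = b])
          (quotient_arc o C a b).
Proof. exact: arcP. Qed.

Lemma acyclic_rev o C : (forall s, cycle (quotient_arc o C) s -> s = [::]) <->
  (forall s, cycle (arc (component C \o stop o) (component C \o start o) C) s -> s = [::]).
Proof.
have E s : cycle (arc (component C \o stop o) (component C \o start o) C) s =
           cycle (quotient_arc o C) (rev s).
  rewrite rev_cycle; apply: eq_cycle; exact: quotient_arc_rev.
split=> acyc s.
  by rewrite E => /acyc /(congr1 rev); rewrite revK.
by rewrite -{1}[s]revK -E => /acyc /(congr1 rev); rewrite revK.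
Qed.

(** In the reversed quotient the block [s] of the complement of [I] is the source and the block [t]
    of [I] the target. Initiality and finality give the arcs in and out that [domination_acyclic]
    requires, and the blocks other than [s] number [rk C]. *)
Lemma cut_term_cut o C : is_cut I o C -> cut_term o C = (-1) ^+ rk C.
Proof.
have [[i iI] [j jI]] := (wall_index_in, wall_index_notin).
case=> _ ends acyc init final; rewrite cut_term_domination.
pose s := component C (att G j); pose t := component C (att G i).
have -> : component C @: (att G @: I) = [set t].
  apply/setP=> a; rewrite inE; apply/imsetP/eqP=> [[_ /imsetP[i' i'I ->] ->]|->].
    by apply/componentP; rewrite ends i'I iI.
  by exists (att G i); rewrite ?imset_f.
have -> : component C @: (att G @: ~: I) = [set s].
  apply/setP=> a; rewrite inE; apply/imsetP/eqP=> [[_ /imsetP[j' + ->] ->]|->].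
    by rewrite inE => j'I; apply/componentP; rewrite ends (negPf j'I) (negPf jI).
  by exists (att G j); rewrite ?imset_f ?inE.
(* Blocks are named by their roots, so the other vertices are isolated in the quotient. Adding them
   to the sources leaves exactly the blocks other than [s] outside. *)
pose nonroot := [set v | v \notin fingraph.roots (joined C)].
have st : s != t by apply/eqP=> /componentP; rewrite ends iI (negPf jI).
transitivity (domination (component C \o stop o) (component C \o start o)
   (s |: nonroot) [set t] C).
  apply: eq_signed_sum => D _; apply/reachP/reachP.
    move=> [a [b [/set1P-> bt ab]]]; exists s, b; by rewrite setU11.
  move=> [a [b [+ bt]]]; rewrite !inE => /orP[/eqP->|aN ab]; first by exists s, b; rewrite inE.
  case/negP: aN; case/connectP: ab => -[/= _ <-|c p /= /andP[/arcP[e [_ <- _]]] _ _].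
    by move/set1P: bt => ->; apply: component_root.
  exact: component_root.
have reach_s v : v \in fingraph.roots (joined C) -> connect (quotient_arc o C) v s.
  by move=> rv; have := final j v jI; rewrite (component_id rv).
have reach_t v : v \in fingraph.roots (joined C) -> connect (quotient_arc o C) t v.
  by move=> rv; have := init i v iI; rewrite (component_id rv).
have outS v : v \notin s |: nonroot -> v \in fingraph.roots (joined C) /\ v != s.
  by rewrite !inE negb_or negbK => /andP[].
rewrite domination_acyclic.
- congr (_ ^+ _); have -> : rk C = #|[set v | v \in fingraph.roots (joined C)] :\ s|.
    rewrite /rk -[n_comp _ _](eq_card (A := [set v | v \in fingraph.roots (joined C)])).
      by rewrite (cardsD1 s) inE component_root.
    by move=> v; rewrite !inE ?andbT.
  by apply: eq_card => v; rewrite !inE negb_or negbK.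
- exact: (acyclic_rev o C).1 acyc.
- move=> e eC; rewrite in_setU1 in_set /= negb_or negbK component_root andbT; apply/eqP=> es.
  have := acyclic_no_back acyc (reach_s _ (component_root C (stop o e))).
  by case/negP; apply/quotient_arcP; exists e.
- move=> v /outS[rv vs]; case/connectP: (reach_s v rv) => -[|c p] /=.
    by move=> _ /esym/eqP; rewrite (negPf vs).
  by case/andP=> /quotient_arcP[e [eC ev _]] _ _; exists e.
- move=> v /outS[rv vs] vt; case/connectP: (reach_t v rv) => p.
  elim/last_ind: p => [_ /eqP|p w _]; first by rewrite (negPf vt).
  rewrite rcons_path last_rcons => /andP[_ /quotient_arcP[e [eC _ ew]]] ->.
  by exists e.
Qed.

End Cuts.

(** * Supplies on the two sides of the wall and the blocks of a quotient *)

Section Crossing.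
Variables (R : realFieldType) (n g : nat) (G : xgraph n g).
Implicit Types (o : orientation G) (C E D : {set 'I_(nedge G)}) (v : 'I_(nvert G)).
Implicit Types (I J : {set 'I_n}) (T : {set 'I_(nvert G)}) (y : 'I_n -> R).

(** No edge of [o] enters [T], so a positive flow along [o] can only leave [T]. *)
Definition closed_in o T := forall e, stop o e \in T -> start o e \in T.

Definition supply y T := \sum_(i in att G @^-1: T) y i.

Lemma sum_setC y J : \sum_i y i = 0 -> \sum_(i in ~: J) y i = - \sum_(i in J) y i.
Proof.
move=> y0; apply/eqP; rewrite -addr_eq0 addrC; apply/eqP; rewrite -[RHS]y0.
rewrite [RHS](bigID (mem J)) /=; congr (_ + _); apply: eq_bigl => i; by rewrite inE.
Qed.

(* [y1] and [y2] sit just before and just after the wall of [I], and [o] is the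
   sign vector of a flow with boundary values [y2]. *)
Record crossing I o y1 y2 : Prop := Crossing {
  crossing_total1 : \sum_i y1 i = 0;
  crossing_total2 : \sum_i y2 i = 0;
  crossing_neg : \sum_(i in I) y1 i < 0;
  crossing_pos : 0 < \sum_(i in I) y2 i;
  crossing_adj : forall J, J != I ->
    0 <= \sum_(i in J) y2 i -> 0 <= \sum_(i in J) y1 i;
  crossing_closed : forall T, closed_in o T -> T != set0 -> T != setT ->
    0 < supply y2 T }.

Lemma crossing_wall I o y1 y2 : crossing I o y1 y2 -> wall_index I.
Proof.
case=> y10 _ neg _ _ _; apply/andP; split; apply: contraTneq neg => ->.
  by rewrite big_set0 ltxx.
by rewrite (eq_bigl xpredT) ?y10 ?ltxx // => i; rewrite inE.
Qed.

Lemma crossing_supply I o y1 y2 T : crossing I o y1 y2 -> closed_in o T -> 0 <= supply y2 T.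
Proof.
case=> _ y20 _ _ _ pos Tin.
have [->|T0] := eqVneq T set0.
  by rewrite /supply big1 // => i; rewrite !inE.
have [->|TT] := eqVneq T setT.
  by rewrite /supply (eq_bigl xpredT) ?y20 // => i; rewrite !inE.
exact/ltW/pos.
Qed.

(* Reversing all edges, changing the sign of the boundary values and exchanging
   [I] with its complement exchanges sources with sinks. *)
Lemma crossing_dual I o y1 y2 : crossing I o y1 y2 ->
  crossing (~: I) (reverse o setT) (\- y1) (\- y2).
Proof.
case=> y10 y20 neg pos adj cl.
have sumN y J : \sum_i y i = 0 -> \sum_(i in J) (\- y) i = \sum_(i in ~: J) y i.
  by move=> y0; rewrite sum_setC //= sumrN.
split.
- by rewrite /= sumrN y10 oppr0.
- by rewrite /= sumrN y20 oppr0.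
- by rewrite sumN // setCK.
- by rewrite sumN // setCK.
- by move=> J JI; rewrite !sumN //; apply: adj; apply: contraNneq JI => <-; rewrite setCK.
move=> T Tin T0 TT; rewrite /supply sumN // -preimsetC; apply: cl.
- move=> e; rewrite !inE; apply: contra => sT.
  by have := Tin e; rewrite start_reverse stop_reverse inE; apply.
- by apply: contraNneq TT => T0'; rewrite -[T]setCK T0' setC0.
- by apply: contraNneq T0 => TT'; rewrite -[T]setCK TT' setCT.
Qed.

Section NonCut.
Variables (I : {set 'I_n}) (o : orientation G) (y1 y2 : 'I_n -> R).
Hypothesis cross : crossing I o y1 y2.

(** No edge would enter or leave a block with ends of both kinds. Its supply would be positive and
    that of its complement nonnegative, although they add up to zero. *)
Lemma crossing_mixed_block C i j : i \in I -> j \notin I ->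
    {in C, forall e, component C (stop o e) \notin component C @: (att G @: I)} ->
    {in C, forall e, component C (start o e) \notin component C @: (att G @: ~: I)} ->
    {in C, forall e, component C (start o e) != component C (stop o e)} -> C != set0 ->
  component C (att G i) != component C (att G j).
Proof.
move=> iI jI inI outI noloop /set0Pn[e eC]; apply/eqP => ij.
pose K := [set v | component C v == component C (att G i)].
have Kin : closed_in o K.
  move=> f; rewrite !inE => /eqP sf; have [fC|fC] := boolP (f \in C).
    by case/negP: (inI f fC); rewrite sf !imset_f.
  by rewrite (component_edge o fC) sf.
have Kout : closed_in o (~: K).
  move=> f; rewrite !inE; apply: contra => /eqP sf; have [fC|fC] := boolP (f \in C).
    by case/negP: (outI f fC); rewrite sf ij !imset_f ?inE.
  by rewrite -(component_edge o fC) sf.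
have K0 : K != set0 by apply/set0Pn; exists (att G i); rewrite inE.
have KT : K != setT.
  apply: contraNneq (noloop e eC) => KT.
  have := in_setT (start o e); have := in_setT (stop o e).
  by rewrite -KT !inE => /eqP-> /eqP->.
have := crossing_closed cross Kin K0 KT.
have := crossing_supply cross Kout.
by rewrite /supply preimsetC (sum_setC _ (crossing_total2 cross)) oppr_ge0 leNgt => /negP.
Qed.

(** Suppose that [I] meets several blocks. The block of [i] and the union of the others are entered
    by no edge, so their supplies are nonnegative at [y2]. Neither carries exactly the ends [I], so
    this persists at [y1], where the two supplies add up to the negative sum over [I]. *)
Lemma crossing_one_block C i j : i \in I -> j \in I ->
    {in C, forall e, component C (stop o e) \notin component C @: (att G @: I)} ->
    {in C, forall e, component C (start o e) \notin component C @: (att G @: ~: I)} ->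
    {in C, forall e, component C (start o e) != component C (stop o e)} -> C != set0 ->
  component C (att G i) = component C (att G j).
Proof.
move=> iI jI inI outI noloop C0; apply/eqP/negPn/negP=> ij.
pose K1 := [set v | component C v == component C (att G i)].
pose K2 := [set v | component C v \in component C @: (att G @: I)] :\: K1.
have mixed i' j' (hi : i' \in I) (hj : j' \notin I) :=
  crossing_mixed_block hi hj inI outI noloop C0.
have ends v : component C v \in component C @: (att G @: I) ->
    forall e, stop o e = v -> component C (start o e) = component C v.
  move=> vI e ev; have [eC|/(component_edge o) ->] := boolP (e \in C); last by rewrite ev.
  by case/negP: (inI e eC); rewrite ev.
have K1in : closed_in o K1.
  move=> e; rewrite !inE => /eqP se.
  by rewrite (ends (stop o e)) // ?se // imset_f ?imset_f.
have K2in : closed_in o K2.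
  by move=> e; rewrite !inE => /andP[nK1 vI]; rewrite (ends (stop o e)) // nK1.
have K10 : K1 != set0 by apply/set0Pn; exists (att G i); rewrite inE.
have K1T : K1 != setT.
  by apply/eqP=> /setP/(_ (att G j)); rewrite !inE eq_sym (negPf ij).
have K20 : K2 != set0.
  by apply/set0Pn; exists (att G j); rewrite !inE eq_sym ij imset_f ?imset_f.
have K2T : K2 != setT.
  by apply/eqP=> /setP/(_ (att G i)); rewrite !inE eqxx.
have J1I : att G @^-1: K1 != I.
  by apply/eqP=> /setP/(_ j); rewrite !inE jI eq_sym (negPf ij).
have J2I : att G @^-1: K2 != I.
  by apply/eqP=> /setP/(_ i); rewrite !inE iI eqxx.
have := crossing_adj cross J1I (crossing_supply cross K1in).
have := crossing_adj cross J2I (crossing_supply cross K2in).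
have := crossing_neg cross; rewrite (big_setID (att G @^-1: K1)) /=.
have -> : I :&: att G @^-1: K1 = att G @^-1: K1.
  apply/setP=> k; rewrite !inE andbC; case: eqVneq => //= ki.
  by apply/negPn/negP=> /(mixed _ _ iI)/eqP; rewrite ki.
have -> : I :\: att G @^-1: K1 = att G @^-1: K2.
  apply/setP=> k; rewrite !inE; congr (_ && _); apply/idP/imsetP=> [kI|].
    by exists (att G k); rewrite ?imset_f.
  case=> _ /imsetP[i' i'I ->] ki; apply/negPn/negP=> /(mixed _ _ i'I)/eqP; by rewrite ki.
by move=> neg p2 p1; rewrite ltNge addr_ge0 in neg.
Qed.

(** A block without an incoming arc would have positive supply. Its ends, however, are either none
    or the whole complement of [I], whose sum is negative at [y2]. *)
Lemma crossing_in_arc C i v : i \in I -> v \in fingraph.roots (joined C) ->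
    (forall j k, component C (att G j) = component C (att G k) -> (j \in I) = (k \in I)) ->
    (forall j k, j \notin I -> k \notin I -> component C (att G j) = component C (att G k)) ->
    (forall j, j \in I -> component C (att G j) = component C (att G i)) ->
  v != component C (att G i) ->
  exists2 u, u \in fingraph.roots (joined C) & quotient_arc o C u v.
Proof.
move=> iI rv sep oneC one vi.
have [/existsP[u /andP[ru uv]]|/existsPn nou] :=
  boolP [exists u, (u \in fingraph.roots (joined C)) && quotient_arc o C u v].
  by exists u.
pose K := [set w | component C w == v].
have Kin : closed_in o K.
  move=> e; rewrite !inE => /eqP se; have [eC|/(component_edge o) -> //] := boolP (e \in C).
    have := nou (component C (start o e)); rewrite component_root /=.
    by case/negP; apply/quotient_arcP; exists e.
  by apply/eqP.
have K0 : K != set0 by apply/set0Pn; exists v; rewrite inE component_id.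
have KT : K != setT.
  by apply/eqP=> /setP/(_ (att G i)); rewrite !inE eq_sym (negPf vi).
have := crossing_closed cross Kin K0 KT; rewrite /supply.
have [/set0Pn[j]|] := boolP (att G @^-1: K != set0); last first.
  by rewrite negbK => /eqP->; rewrite big_set0 ltxx.
rewrite !inE => /eqP jv.
have jI : j \notin I by apply: contraNN vi => /one <-; rewrite jv.
have -> : att G @^-1: K = ~: I.
  apply/setP=> k; rewrite !inE; apply/eqP/idP=> [kv|kI].
    by rewrite (sep k j) // kv jv.
  by rewrite -jv (oneC k j).
rewrite (sum_setC _ (crossing_total2 cross)) oppr_gt0 => /ltW.
by rewrite leNgt (crossing_pos cross).
Qed.

End NonCut.

End Crossing.

(** * Alternating sums over the cuts above a given edge set *)

Section CutSums.
Variables (R : realFieldType) (n g : nat) (G : xgraph n g).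
Variables (I : {set 'I_n}) (o : orientation G) (y1 y2 : 'I_n -> R).
Hypothesis cross : crossing I o y1 y2.
Implicit Types (C D E : {set 'I_(nedge G)}) (T : {set 'I_(nvert G)}).

Lemma quotient_arc_dual C :
  quotient_arc (reverse o setT) C =2 [rel a b | quotient_arc o C b a].
Proof.
move=> a b; apply: eq_existsb => e.
by rewrite start_reverse stop_reverse inE [X in _ && X]andbC.
Qed.

Lemma acyclic_no_loop C : (forall s, cycle (quotient_arc o C) s -> s = [::]) ->
  {in C, forall e, component C (start o e) != component C (stop o e)}.
Proof.
move=> acyc e eC; apply/eqP=> ee; have := acyc [:: component C (start o e)].
have -> : cycle (quotient_arc o C) [:: component C (start o e)].
  by rewrite /= andbT; apply/quotient_arcP; exists e.
by move=> /(_ isT).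
Qed.

(** A nonzero domination excludes directed cycles, arcs into blocks with an end of [I] and arcs out
    of blocks with an end of the complement. The supply arguments turn this into the cut conditions;
    those on the complement of [I] come from the dual crossing. *)
Lemma cut_term_neq0 C : C != set0 -> cut_term I o C != 0 -> is_cut I o C.
Proof.
move=> C0; rewrite cut_term_domination => dom0.
have hI := crossing_wall cross; have cross' := crossing_dual cross.
have [[i iI] [j jI]] := (wall_index_in hI, wall_index_notin hI).
have acyc' s : cycle (arc (component C \o stop o) (component C \o start o) C) s -> s = [::].
  move=> cyc; apply/eqP/negPn/negP=> s0; case/eqP: dom0.
  exact: domination_cyclic s0 cyc.
have acyc : forall s, cycle (quotient_arc o C) s -> s = [::] by apply/acyclic_rev.
have inI : {in C, forall e, component C (stop o e) \notin component C @: (att G @: I)}.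
  move=> e eC; apply: contraNN dom0 => eI.
  by rewrite (@domination_tail0 _ _ (component C \o stop o) _ _ _ _ _ eC).
have outI : {in C, forall e, component C (start o e) \notin component C @: (att G @: ~: I)}.
  move=> e eC; apply: contraNN dom0 => eI.
  by rewrite (@domination_head0 _ _ (component C \o stop o)
    (component C \o start o) _ _ _ _ eC).
have noloop : {in C, forall e, component C (start o e) != component C (stop o e)}.
  exact: acyclic_no_loop acyc.
have mixed k l (hk : k \in I) (hl : l \notin I) :=
  crossing_mixed_block cross hk hl inI outI noloop C0.
have one k l (hk : k \in I) (hl : l \in I) :=
  crossing_one_block cross hk hl inI outI noloop C0.
have one' k l : k \notin I -> l \notin I -> component C (att G k) = component C (att G l).
  move=> kI lI; apply: (crossing_one_block cross'); rewrite ?inE //.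
  - by move=> e eC; rewrite stop_reverse inE outI.
  - by move=> e eC; rewrite start_reverse inE setCK inI.
  - by move=> e eC; rewrite start_reverse stop_reverse inE eq_sym noloop.
have sep k l : component C (att G k) = component C (att G l) -> (k \in I) = (l \in I).
  move=> kl; apply/idP/idP=> [kI|lI]; apply/negPn/negP.
    by move/(mixed _ _ kI); rewrite kl eqxx.
  by move/(mixed _ _ lI); rewrite kl eqxx.
split => //.
- apply/card_gt1P; exists (component C (att G i)), (component C (att G j)).
  by split; rewrite ?mixed // inE /= andbT; apply: component_root.
- move=> k l; apply/componentP/eqP=> [/sep //|kl].
  by have [kI|kI] := boolP (k \in I); [apply: one|apply: one']; rewrite ?kI // -kl.
- move=> k v kI; apply: (acyclic_from (S := [set v | v \in fingraph.roots (joined C)])) => //.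
    move=> w; rewrite inE => rw wk; have [|u ru uw] := crossing_in_arc cross kI rw sep one' _ wk.
      by move=> l lI; apply: one.
    by exists u; rewrite ?inE.
  by rewrite inE component_root.
- move=> k v kI.
  have /= <- := connect_rev (quotient_arc o C) (component C (att G k)) (component C v).
  rewrite -(eq_connect (quotient_arc_dual C)).
  apply: (acyclic_from (S := [set v | v \in fingraph.roots (joined C)])) => //.
  + move=> s cyc; apply: acyc'.
    by rewrite (eq_cycle (quotient_arc_rev o C)) -(eq_cycle (quotient_arc_dual C)).
  + move=> w; rewrite inE => rw wk; have kI' : k \in ~: I by rewrite inE.
    have [|||u ru uw] := crossing_in_arc cross' kI' rw _ _ _ wk.
    * by move=> l m; rewrite !inE => /sep ->.
    * by move=> l m; rewrite !inE !negbK; apply: one.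
    * by move=> l; rewrite inE => lI; apply: one'.
    by exists u; rewrite ?inE.
  + by rewrite inE component_root.
Qed.

(** Sets that are not cuts contribute zero, so the sum extends to all sets above [E], where the edge
    expansion applies. *)
Lemma sum_cuts E :
  \sum_(C in Cuts I o | E \subset C) (-1) ^+ rk C =
  signed_sum E (fun D => reach (att G @: ~: I) (att G @: I)
                          (steps (start o) (stop o) (~: E) D)).
Proof.
rewrite -edge_expansion_above [RHS](bigID (mem (Cuts I o))) /=.
rewrite [X in _ = _ + X]big1 ?addr0 => [|C /andP[_]].
  rewrite [RHS](eq_bigl (fun C => (C \in Cuts I o) && (E \subset C))).
    apply: eq_bigr => C /andP[]; rewrite inE => /orP[/eqP->|/asboolP cutC] _.
      by rewrite rk_set0 -/(cut_term _ _ _) (cut_term_set0 (crossing_wall cross)).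
    by rewrite -/(cut_term _ _ _) (cut_term_cut (crossing_wall cross)).
  by move=> C; rewrite andbC.
rewrite inE negb_or => /andP[C0 /asboolPn ncut].
by apply/eqP/negPn/negP=> /(cut_term_neq0 C0).
Qed.

(* Uncrossing the violated set [T] with the two extreme blocks of the cut. *)
Lemma cut_not_above C E T : is_cut I o C -> E \subset C ->
    closed_in (reverse o E) T -> att G @^-1: T != I ->
  0 <= \sum_(i in att G @^-1: T) y1 i.
Proof.
case=> _ ends acyc init final EC Tin JI.
have hI := crossing_wall cross.
have [[i iI] [j jI]] := (wall_index_in hI, wall_index_notin hI).
have arcC e : e \in C -> quotient_arc o C (component C (start o e)) (component C (stop o e)).
  by move=> eC; apply/quotient_arcP; exists e.
have noloop e : e \in C -> component C (start o e) != component C (stop o e).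
  exact: acyclic_no_loop acyc e.
have crossT e : stop o e \in T -> start o e \notin T -> e \in C.
  move=> stT saT; apply/(subsetP EC)/negPn/negP=> eE; case/negP: saT.
  by have := Tin e; rewrite start_reverse stop_reverse (negPf eE); apply.
(* [S0] is the block of [I], and [S1] is everything but the block of the complement. By initiality
   and finality no edge of [o] enters either. *)
pose S0 := [set v | component C v == component C (att G i)].
pose S1 := [set v | component C v != component C (att G j)].
have S0in : closed_in o S0.
  move=> e; rewrite !inE => /eqP se; have [eC|/(component_edge o)->] := boolP (e \in C).
    have := acyclic_no_back acyc (init i (start o e) iI).
    by rewrite -se arcC.
  by apply/eqP.
have S1in : closed_in o S1.
  move=> e; rewrite !inE; apply: contraNneq => se.
  have [eC|/(component_edge o)<-] := boolP (e \in C).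
    have := acyclic_no_back acyc (final j (stop o e) jI).
    by rewrite -se arcC.
  by apply/eqP.
have ends0 : att G @^-1: S0 = I.
  apply/setP=> k; rewrite !inE; apply/eqP/idP=> [/componentP|kI].
    by rewrite ends iI => /eqP/esym; case: (k \in I).
  by apply/componentP; rewrite ends kI iI.
have ends1 : att G @^-1: S1 = I.
  apply/setP=> k; rewrite !inE; apply/idP/idP=> [|kI].
    by apply: contraNT => kI; apply/eqP/componentP; rewrite ends (negPf kI) (negPf jI).
  by apply/eqP=> /componentP; rewrite ends kI (negPf jI).
(* An edge of [o] entering [T] lies in [C] and joins different blocks, so it cannot stay within the
   single block [S0], nor within the single block outside [S1]. *)
have T0in : closed_in o (T :&: S0).
  move=> e; rewrite !inE => /andP[stT stS].
  have saS : start o e \in S0 by apply: S0in; rewrite inE.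
  move: (saS); rewrite inE => ->; rewrite andbT; apply/negPn/negP=> /(crossT e stT) eC.
  by have := noloop e eC; rewrite (eqP stS); move: saS; rewrite inE => ->.
have T1in : closed_in o (T :|: S1).
  move=> e; rewrite [_ \in _ :|: _]inE [start o e \in _ :|: _]inE.
  have [saS|saS] := boolP (start o e \in S1); first by rewrite orbT.
  rewrite orbF; have [stS|stS] := boolP (stop o e \in S1); first by rewrite (S1in e) in saS.
  rewrite orbF => stT; apply/negPn/negP=> /(crossT e stT) eC; have := noloop e eC.
  by move: saS stS; rewrite !inE !negbK => /eqP-> /eqP->; rewrite eqxx.
have := crossing_supply cross T1in; have := crossing_supply cross T0in.
rewrite /supply preimsetI preimsetU ends0 ends1; set J := att G @^-1: T in JI *.
move=> p0 p1.
have [J0|J0] := eqVneq (J :&: I) I.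
  by apply: (crossing_adj cross JI); move: p1; have /setIidPr/setUidPl -> := J0.
have [J1|J1] := eqVneq (J :|: I) I.
  by apply: (crossing_adj cross JI); move: p0; have /setUidPr/setIidPl -> := J1.
(* The sums over [J :&: I] and [J :|: I] are nonnegative at [y1] and the sum over [I] is negative
   there, so modularity settles the sum over [J]. *)
have := crossing_adj cross J0 p0; have := crossing_adj cross J1 p1.
have UE : \sum_(k in J :|: I) y1 k = \sum_(k in J) y1 k + \sum_(k in I :\: J) y1 k.
  rewrite (big_setID J) /=; congr (_ + _); apply: eq_bigl => k; rewrite !(in_setU, in_setI, in_setD).
    by case: (k \in J); rewrite ?andbF.
  by case: (k \in J).
have IE : \sum_(k in I) y1 k = \sum_(k in J :&: I) y1 k + \sum_(k in I :\: J) y1 k.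
  by rewrite (big_setID J) /= setIC.
by have := crossing_neg cross; rewrite UE IE; lra.
Qed.

(** No path of steps leads from outside [T] into [T]. If the ends at [T] are exactly [I], there is
    no path at all. If they are none or all, some edge of [E] crosses the boundary of [T] and
    toggling it is irrelevant. Otherwise no cut contains [E]. *)
Lemma sum_cuts_eq0 E T : closed_in (reverse o E) T -> T != set0 -> T != setT ->
    [\/ att G @^-1: T = set0, att G @^-1: T = setT | \sum_(i in att G @^-1: T) y1 i < 0] ->
  \sum_(C in Cuts I o | E \subset C) (-1) ^+ rk C = 0 :> int.
Proof.
move=> Tin T0 TT Jneg; have y20 := crossing_total2 cross.
have connT D a b : D \subset E -> connect (steps (start o) (stop o) (~: E) D) a b ->
    b \in T -> a \in T.
  move=> DE /connectP[p]; elim: p a => [a _ -> //|c p IHp] a /=.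
  case/andP=> ac cp b_last /(IHp _ cp b_last) {cp b_last}.
  case/orP: ac => /arcP[e [eD <- <-]]; have := Tin e; rewrite start_reverse stop_reverse.
    by move: eD; rewrite inE => /negPf ->.
  by rewrite (subsetP DE e eD).
(* A proper nonempty set without edges of [o] entering it has positive supply, so with zero supply
   some edge enters [T] in [o]; it must be one of the reversed ones. *)
have backE : supply y2 T = 0 -> exists e, [/\ e \in E, stop o e \in T & start o e \notin T].
  move=> s0; have [/existsP[e /and3P[eE stT saT]]|/existsPn none] :=
    boolP [exists e, [&& e \in E, stop o e \in T & start o e \notin T]]; first by exists e.
  suff To : closed_in o T by have := crossing_closed cross To T0 TT; rewrite s0 ltxx.
  move=> e stT; have := none e; have := Tin e; rewrite stT start_reverse stop_reverse.
  case: (e \in E) => [_ /=|/(_ stT)//]; by rewrite negbK.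
have [JI|JI] := eqVneq (att G @^-1: T) I.
  rewrite sum_cuts /signed_sum big1 // => D; rewrite powersetE => DE.
  case: reachP => [[_ [_ [/imsetP[j jI ->] /imsetP[i iI ->] ji]]]|]; last by rewrite mulr0.
  have := connT _ _ _ DE ji; have : i \in att G @^-1: T by rewrite JI.
  by rewrite inE => -> /(_ isT); move: jI; rewrite -JI !inE => /negPf->.
case: Jneg => [J0|JT|Jneg].
- have [|e [eE stT saT]] := backE; first by rewrite /supply J0 big_set0.
  rewrite sum_cuts; apply: (signed_sum_irrelevant eE) => D DE eD.
  rewrite (reach_add (u := stop o e) (w := start o e) (r := steps (start o) (stop o) (~: E) D)).
    apply/orb_idr => /andP[/fromP[_ /imsetP[j _ ->] je] _].
    have := connT _ _ _ DE je stT; have : j \notin att G @^-1: T by rewrite J0 inE.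
    by rewrite inE => /negPf->.
  by move=> a b; rewrite /steps arcU1 orbA.
- have [|e [eE stT saT]] := backE.
    by rewrite /supply JT (eq_bigl xpredT) // => i; rewrite inE.
  rewrite sum_cuts; apply: (signed_sum_irrelevant eE) => D DE eD.
  rewrite (reach_add (u := stop o e) (w := start o e) (r := steps (start o) (stop o) (~: E) D)).
    apply/orb_idr => /andP[_ /intoP[_ /imsetP[i _ ->] ei]].
    have := connT _ _ _ DE ei; have : i \in att G @^-1: T by rewrite JT inE.
    by rewrite inE => -> /(_ isT); rewrite (negPf saT).
  by move=> a b; rewrite /steps arcU1 orbA.
- rewrite big1 // => C; rewrite inE => /andP[/orP[/eqP->|/asboolP cutC] EC].
    have E0 : E = set0 by apply/eqP; rewrite -subset0.
    have To : closed_in o T.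
      by move=> e; have := Tin e; rewrite E0 start_reverse stop_reverse inE.
    by have := crossing_adj cross JI (crossing_supply cross To); rewrite leNgt Jneg.
  by have := cut_not_above cutC EC Tin JI; rewrite leNgt Jneg.
Qed.

End CutSums.

(** * Flows *)

Section Transshipment.
Variables (R : realFieldType) (V Ed : finType) (tl hd : Ed -> V).
Implicit Types (S T : {set V}) (K : {set Ed}) (f h : Ed -> R) (b : V -> R).

Definition net f v := \sum_(e | tl e == v) f e - \sum_(e | hd e == v) f e.

Lemma sum_net f T :
  \sum_(v in T) net f v = \sum_e f e * ((tl e \in T)%:R - (hd e \in T)%:R).
Proof.
have sumT (p : Ed -> V) :
    \sum_(v in T) \sum_(e | p e == v) f e = \sum_e f e * (p e \in T)%:R.
  transitivity (\sum_(e | p e \in T) f e).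
    rewrite (partition_big p (mem T)) //=; apply: eq_bigr => v vT.
    by apply: eq_bigl => e; case: eqP => [->|]; rewrite ?vT ?andbF.
  by rewrite big_mkcond; apply: eq_bigr => e _; case: ifP; rewrite ?mulr1 ?mulr0.
rewrite sumrB !sumT -sumrB; apply: eq_bigr => e _; by rewrite mulrBr.
Qed.

Lemma sum_setT (J : finType) (F : J -> R) : \sum_(j in [set: J]) F j = \sum_j F j.
Proof. by apply: eq_bigl => j; rewrite inE. Qed.

Lemma sum_net_setT f : \sum_v net f v = 0.
Proof.
by rewrite -sum_setT sum_net big1 // => e _; rewrite !inE subrr mulr0.
Qed.

Definition closed_under K T := [forall e in K, (hd e \in T) ==> (tl e \in T)].

Lemma closed_underP K T :
  reflect {in K, forall e, hd e \in T -> tl e \in T} (closed_under K T).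
Proof.
apply: (iffP forall_inP) => cl e eK; first by move/implyP: (cl e eK).
by apply/implyP/cl.
Qed.

Lemma sum_setIU b S T :
  \sum_(v in S) b v + \sum_(v in T) b v =
  \sum_(v in S :&: T) b v + \sum_(v in S :|: T) b v.
Proof.
have -> : \sum_(v in S :|: T) b v = \sum_(v in S) b v + \sum_(v in T :\: S) b v.
  rewrite (big_setID S) /=; congr (_ + _); apply: eq_bigl => v; rewrite !inE.
    by case: (v \in S); rewrite ?andbF.
  by case: (v \in S).
by rewrite addrCA [X in _ + X = _](big_setID S) /= setIC.
Qed.

(* Hoffman's theorem by induction on the arcs: the values that an arc may carry
   are bounded below and above by set functions which are compatible by
   uncrossing. *)
Lemma transshipment K b : \sum_v b v = 0 ->
    (forall T, closed_under K T -> 0 <= \sum_(v in T) b v) ->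
  exists f, [/\ forall e, 0 <= f e, forall e, e \notin K -> f e = 0
              & forall v, net f v = b v].
Proof.
have [m] := ubnP #|K|; elim: m K b => // m IHm K b /ltnSE leKm b0 bK.
have [K0|/set0Pn[a aK]] := eqVneq K set0.
  exists (fun=> 0); split => // v; rewrite /net !big1 // subr0.
  have bK' T : 0 <= \sum_(u in T) b u.
    by apply: bK; apply/closed_underP => e; rewrite K0 inE.
  have := bK' [set v]; have := bK' (~: [set v]); have := b0.
  rewrite big_set1 (bigD1 v) //= [X in _ -> 0 <= X -> _](eq_bigl (fun u => u != v)) => [|u].
    by lra.
  by rewrite !inE.
(* The sets that [a] alone enters. Each needs at least the negative of its supply to come in through
   [a], and [t] is the least nonnegative amount meeting all these demands. *)
pose low T := [&& closed_under (K :\ a) T, hd a \in T & tl a \notin T].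
pose t := \big[Num.max/0]_(T : {set V} | low T) - \sum_(v in T) b v.
have t0 : 0 <= t by apply: bigmax_ge_id.
pose b' v := b v - t * (v == tl a)%:R + t * (v == hd a)%:R.
have sumb' T : \sum_(v in T) b' v =
    \sum_(v in T) b v - t * (tl a \in T)%:R + t * (hd a \in T)%:R.
  have sumt u : \sum_(v in T) t * (v == u)%:R = t * (u \in T)%:R.
    have [uT|uT] := boolP (u \in T); last first.
      by rewrite big1 ?mulr0 // => v vT; case: eqP vT => [->|]; rewrite ?(negPf uT) ?mulr0.
    by rewrite (bigD1 u) //= eqxx big1 ?addr0 // => v /andP[_ /negPf->]; rewrite mulr0.
  by rewrite /b' big_split /= sumrB !sumt.
have ltKa : (#|K :\ a| < m)%N by rewrite (leq_trans _ leKm) // [in leqRHS](cardsD1 a) aK.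
have closedK T : closed_under (K :\ a) T -> (hd a \in T -> tl a \in T) -> closed_under K T.
  move=> /closed_underP clT aT; apply/closed_underP => e eK.
  by have [->//|ea] := eqVneq e a; apply: clT; rewrite !inE ea.
have [||f' [f'0 f'K f'b]] := IHm (K :\ a) b' ltKa.
- by have := sumb' setT; rewrite !sum_setT !inE b0 => ->; rewrite sub0r addNr.
- move=> T clT; rewrite sumb'.
  have [hT|hT] := boolP (hd a \in T); have [tT|tT] := boolP (tl a \in T).
  + have := bK T (closedK T clT _); rewrite tT => /(_ (fun=> isT)); lra.
  + have : - \sum_(v in T) b v <= t.
      apply: (le_bigmax_cond _ (fun T : {set V} => - \sum_(v in T) b v)).
      by rewrite /low clT hT tT.
    by rewrite /=; lra.
  + suff : t <= \sum_(v in T) b v by rewrite /=; lra.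
    have bT : 0 <= \sum_(v in T) b v by apply/bK/closedK; rewrite // (negPf hT).
    apply: bigmax_le => // S /and3P[/closed_underP clS hS tS].
    move/closed_underP: clT => clT.
    (* The arc [a] enters neither the intersection nor the union of [S] and [T], so both are closed
       under all of [K]. *)
    rewrite lerNl -subr_ge0 opprK addrC sum_setIU addr_ge0 //; apply/bK/closedK.
    * by apply/closed_underP => e eK; rewrite !inE => /andP[/(clT _ eK)-> /(clS _ eK)->].
    * by rewrite !inE (negPf hT).
    * by apply/closed_underP => e eK; rewrite !inE => /orP[/(clT _ eK)->|/(clS _ eK)->]; rewrite ?orbT.
    * by rewrite !inE tT.
  + have := bK T (closedK T clT _); rewrite (negPf hT)
      => /(_ (fun H => False_ind _ (notF H))).
    by rewrite /=; lra.
exists (fun e => f' e + t * (e == a)%:R); split.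
- by move=> e; rewrite addr_ge0 ?mulr_ge0 ?ler0n.
- move=> e eK; rewrite f'K ?inE ?(negPf eK) ?andbF // add0r.
  by case: eqP eK => [->|]; rewrite ?aK ?mulr0.
move=> v; have sumt (p : Ed -> V) : \sum_(e | p e == v) t * (e == a)%:R = t * (v == p a)%:R.
  have [->|va] := eqVneq v (p a); last first.
    rewrite big1 ?mulr0 // => e /eqP pe; case: eqP => [ea|]; rewrite ?mulr0 //.
    by rewrite -pe ea eqxx in va.
  by rewrite (bigD1 a) //= eqxx big1 ?addr0 // => e /andP[_ /negPf->]; rewrite mulr0.
by have := f'b v; rewrite /net /b' !big_split /= !sumt; lra.
Qed.

Lemma finite_lower_bound (J : finType) (P : pred J) (F : J -> R) :
  (forall j, P j -> 0 < F j) -> exists2 eps, 0 < eps & forall j, P j -> eps <= F j.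
Proof.
move=> F0; exists (\big[Num.min/1]_(j | P j) F j).
  by apply: lt_bigmin.
by move=> j Pj; apply: bigmin_le_cond.
Qed.

(** A small amount [d] is reserved on every arc. Strict positivity of the finitely many supplies
    leaves room for it, and [transshipment] routes the rest. *)
Lemma positive_transshipment b : \sum_v b v = 0 ->
    (forall T, closed_under setT T -> T != set0 -> T != setT -> 0 < \sum_(v in T) b v) ->
  exists2 f, forall e, 0 < f e & forall v, net f v = b v.
Proof.
move=> b0 bpos.
have [eps eps0 epsT] : exists2 eps : R, 0 < eps & forall T,
    [&& closed_under setT T, T != set0 & T != setT] -> eps <= \sum_(v in T) b v.
  by apply: finite_lower_bound => T /and3P[]; apply: bpos.
(* At most [#|Ed|] arcs leave a set, so the reserved amounts total at most [eps]; the successor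
   avoids a zero denominator. *)
pose d := eps / #|Ed|.+1%:R.
have d0 : 0 < d by rewrite divr_gt0.
have [||f [f0 _ fb]] := @transshipment setT (fun v => b v - d * net (fun=> 1) v).
- by rewrite sumrB b0 -mulr_sumr sum_net_setT mulr0 subrr.
- move=> T clT; rewrite sumrB -mulr_sumr sum_net subr_ge0.
  have [->|T0] := eqVneq T set0.
    by rewrite big_set0 big1 ?mulr0 // => e _; rewrite !inE subrr mulr0.
  have [->|TT] := eqVneq T setT.
    by rewrite sum_setT b0 big1 ?mulr0 // => e _; rewrite !inE subrr mulr0.
  have epsT0 : eps <= \sum_(v in T) b v by rewrite epsT ?clT ?T0.
  apply: le_trans epsT0.
  rewrite /d -mulrA ger_pMr // mulrC ler_pdivrMr ?ltr0n // mul1r.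
  apply: (@le_trans _ _ (\sum_(e : Ed) 1)).
    apply: ler_sum => e _; rewrite mul1r.
    by case: (_ \in _); case: (_ \in _); rewrite ?subrr ?subr0 ?sub0r //; lra.
  by rewrite sumr_const cardT -cardE ler_nat.
exists (fun e => f e + d) => [e|v]; first by rewrite ltr_wpDl.
have dE (P : pred Ed) : \sum_(e | P e) d = d * \sum_(e | P e) 1.
  by rewrite mulr_sumr; apply: eq_bigr => e _; rewrite mulr1.
by have := fb v; rewrite /net !big_split /= !dE; lra.
Qed.

End Transshipment.

(** * Positive flows along an orientation *)

Section DirectedFlows.
Variables (R : realFieldType) (n g : nat) (G : xgraph n g).
Implicit Types (o : orientation G) (y : 'I_n -> R) (h : 'I_(nedge G) -> R).
Implicit Types (T : {set 'I_(nvert G)}).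

Definition inflow y (v : 'I_(nvert G)) := \sum_(i | att G i == v) y i.

Lemma sum_inflow y T : \sum_(v in T) inflow y v = supply y T.
Proof.
rewrite /supply (partition_big (att G) (mem T)) /= => [|i]; last by rewrite inE.
apply: eq_bigr => v vT; apply: eq_bigl => i; rewrite inE.
by case: eqP => [->|]; rewrite ?vT ?andbF.
Qed.

Lemma sum_inflow_setT y : \sum_v inflow y v = \sum_i y i.
Proof.
by rewrite -(sum_setT (inflow y)) sum_inflow /supply; apply: eq_bigl => i; rewrite !inE.
Qed.

Definition directed_flow o y h :=
  (forall e, 0 < h e) /\ (forall v, net (start o) (stop o) h v = inflow y v).

(** All terms of the net outflow of [T] are nonnegative, and connectedness provides an edge leaving
    [T]. *)
Lemma directed_flow_closed o y h T : directed_flow o y h -> closed_in o T ->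
  T != set0 -> T != setT -> 0 < supply y T.
Proof.
case=> h0 hy Tin /set0Pn[u uT]; rewrite -subTset => /subsetPn[w _ wT].
rewrite -sum_inflow (eq_bigr _ (fun v _ => esym (hy v))) sum_net.
have term e : 0 <= h e * ((start o e \in T)%:R - (stop o e \in T)%:R).
  apply: mulr_ge0; first exact/ltW.
  by have := Tin e; case: (_ \in T) => [/(_ isT)->|_]; rewrite ?subrr // subr0 ler0n.
have [e saT stT] : exists2 e, start o e \in T & stop o e \notin T.
  have [/existsP[e /andP[saT stT]]|/existsPn none] :=
    boolP [exists e, (start o e \in T) && (stop o e \notin T)]; first by exists e.
  suff cl : fingraph.closed (joined (finset.set0 : {set 'I_(nedge G)})) (mem T).
    by have := closed_connect cl (connect_joined0 u w); rewrite /= uT (negPf wT).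
  move=> a b /(joinedP o)[e _ ab]; have := none e; have := Tin e.
  by case: ab => -[<- <-] /=; case: (start o e \in T); case: (stop o e \in T) => // /(_ isT).
rewrite (bigD1 e) //= saT (negPf stT) subr0 mulr1 ltr_pwDl ?h0 //.
by apply: sumr_ge0 => e' _.
Qed.

Lemma directed_flow_exists o y : \sum_i y i = 0 ->
    (forall T, closed_in o T -> T != set0 -> T != setT -> 0 < supply y T) ->
  exists h, directed_flow o y h.
Proof.
move=> y0 pos; have [||h h0 hy] := @positive_transshipment _ _ _ (start o) (stop o) (inflow y).
- by rewrite sum_inflow_setT.
- move=> T /closed_underP clT T0 TT; rewrite sum_inflow; apply: pos => // e.
  by apply: clT; rewrite inE.
by exists h.
Qed.

Lemma netP o (f : 'I_(nedge G) -> R) v :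
  net (start o) (stop o) (fun e => if o e then f e else - f e) v =
  net (@src n g G) (@tgt n g G) f v.
Proof.
rewrite /net [X in X - _]big_mkcond [X in _ - X]big_mkcond -sumrB.
rewrite [X in _ = X - _]big_mkcond [X in _ = _ - X]big_mkcond -sumrB.
apply: eq_bigr => e _; rewrite /start /stop; case: (o e) => //.
by do 2![case: eqP => _]; lra.
Qed.

Lemma flowsP (x : 'rV[R]_n) (f : 'rV[R]_(nedge G)) :
  (forall v : 'I_(nvert G),
     \sum_(e | tgt e == v) f 0 e + \sum_(i | att G i == v) x 0 i =
     \sum_(e | src e == v) f 0 e) <->
  (forall v, net (@src n g G) (@tgt n g G) (f 0) v = inflow (x 0) v).
Proof.
by split=> fx v; have := fx v; rewrite /net /inflow; lra.
Qed.

End DirectedFlows.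

Local Open Scope classical_set_scope.

(** * Signs of continuous functions on connected sets and closures *)

Section SignsOnConnectedSets.
Variables (R : realType) (X : topologicalType).

Lemma connected_sign (B : set X) (phi : X -> R) : connected B -> continuous phi ->
  (forall z, B z -> phi z != 0) -> forall a b, B a -> B b -> 0 < phi a -> 0 < phi b.
Proof.
move=> cB cphi phi0 a b Ba Bb a0; rewrite ltNge; apply/negP => b0.
have /connected_intervalP itv : connected (phi @` B).
  by apply: connected_continuous_connected => //; apply: continuous_subspaceT.
have [|||z Bz z0] := itv (phi b) (phi a) _ _ 0; [by exists b|by exists a|by rewrite b0 ltW|].
by have := phi0 z Bz; rewrite z0 eqxx.
Qed.

Lemma closure_ge0 (B : set X) (phi : X -> R) : continuous phi ->
  (forall z, B z -> 0 <= phi z) -> forall z, topology_structure.closure B z -> 0 <= phi z.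
Proof.
move=> cphi B0 z Bz.
have cl : topology_structure.closed (phi @^-1` [set t | 0 <= t]).
  by apply: (proj1 (continuous_closedP phi) cphi); exact: closed_ge.
by have := closureS B0 Bz; rewrite -((closure_id _).1 cl).
Qed.

End SignsOnConnectedSets.

Section RowVectors.
Variables (R : realType) (n : nat).
Implicit Types (x d : 'rV[R]_n) (J : {set 'I_n}).

Lemma continuous_sum_coord J : continuous (fun x : 'rV[R]_n => \sum_(j in J) x 0 j).
Proof.
exact: (continuous_big (@add_continuous R) (fun j _ => @coord_continuous R 1 n 0 j)).
Qed.

Lemma continuous_line x d : continuous (fun t : R => x + t *: d).
Proof.
move=> t; apply: cvgD; first exact: cvg_cst.
by apply: cvgZr_tmp; exact: cvg_id.
Qed.

Lemma open_line (U : set 'rV[R]_n) x d : open U -> U x -> exists2 t : R, 0 < t & U (x + t *: d).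
Proof.
move=> oU Ux; have : nbhs (0 : R) ((fun t : R => x + t *: d) @^-1` U).
  apply: continuous_line; rewrite /= scale0r addr0; exact: open_nbhs_nbhs.
move/nbhs_ballP => [e /= e0 eU]; exists (e / 2); first by rewrite divr_gt0.
apply: eU; rewrite /ball /= sub0r normrN gtr0_norm ?divr_gt0 //.
by rewrite ltr_pdivrMr // ltr_pMr // ltr1n.
Qed.

End RowVectors.

(** * Chambers and walls *)

Section Chambers.
Variables (R : realType) (n g : nat) (G : xgraph n g) (x : 'rV[R]_n).
Implicit Types (o : orientation G) (f : 'rV[R]_(nedge G)).

Definition sign_vector f : orientation G := [ffun e => 0 < f 0 e].

Lemma arr_complementP f : arr_complement x f <-> flows x f /\ forall e, f 0 e != 0.
Proof.
split=> [[fx nf]|[fx nf]]; split => //.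
  by move=> e; apply/eqP => fe; apply: nf; exists e.
by case=> e _ /eqP; rewrite (negPf (nf e)).
Qed.

Lemma component_sign f f' : connected_component (@arr_complement R n g G x) f f' ->
  sign_vector f' = sign_vector f.
Proof.
move=> ff'; have cf : connected (connected_component (@arr_complement R n g G x) f).
  exact: component_connected.
have sub := @connected_component_sub _ (@arr_complement R n g G x) f.
have Ax : arr_complement x f.
  by apply: contrapT => nA; rewrite connected_component_out in ff'.
have cff := connected_component_refl Ax.
have cont e : continuous (fun f : 'rV[R]_(nedge G) => f 0 e) by exact: coord_continuous.
have nz e z : connected_component (@arr_complement R n g G x) f z -> z 0 e != 0.
  by move=> /sub /arr_complementP[].
apply/ffunP => e; rewrite !ffunE; apply/idP/idP.
  by apply: (connected_sign cf (cont e) (nz e)).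
by apply: (connected_sign cf (cont e) (nz e)).
Qed.

(** The segment between two flows with equal signs consists of flows with these signs, so it stays
    in the complement. *)
Lemma sign_component f f' : arr_complement x f -> arr_complement x f' ->
  sign_vector f' = sign_vector f -> connected_component (@arr_complement R n g G x) f f'.
Proof.
move=> Af Af' ff'; pose seg (t : R) : 'rV[R]_(nedge G) := f + t *: (f' - f).
have cseg : connected (seg @` `[0, 1]).
  apply: connected_continuous_connected; first exact: segment_connected.
  by apply: continuous_subspaceT; exact: continuous_line.
apply: (connected_component_max _ _ cseg); last first.
- by exists 1; rewrite /seg /= ?in_itv /= ?lexx ?ler01 // scale1r addrC subrK.
- move=> _ [t /= + <-]; rewrite in_itv /= => /andP[t0 t1]; apply/arr_complementP.
  have [/arr_complementP[Ff nf] /arr_complementP[Ff' nf']] := (Af, Af').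
  have segE e : seg t 0 e = (1 - t) * f 0 e + t * f' 0 e by rewrite !mxE; lra.
  split.
    apply/flowsP => v; have /flowsP/(_ v) := Ff; have /flowsP/(_ v) := Ff'.
    rewrite /net !(eq_bigr _ (fun e _ => segE e)) !big_split -!mulr_sumr /= => E' E.
    have lin (a b a' b' : R) :
        (1 - t) * a + t * a' - ((1 - t) * b + t * b') = (1 - t) * (a - b) + t * (a' - b').
      by ring.
    by rewrite lin E E' -mulrDl subrK mul1r.
  move=> e; rewrite segE; have := nf e; have := nf' e.
  have := congr1 (fun o : orientation G => o e) ff'; rewrite !ffunE.
  case: (ltgtP 0 (f 0 e)) => // fe + f'0 _.
    move=> f'e; have {}f'e : 0 < f' 0 e by rewrite f'e.
    by rewrite gt_eqF //; nra.
  move=> /negbT; rewrite -leNgt le_eqVlt (negPf f'0) /= => f'e.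
  by rewrite lt_eqF //; nra.
- by exists 0; rewrite /seg /= ?in_itv /= ?lexx ?ler01 // scale0r addr0.
Qed.

Lemma chamberE (B : F_chambers G x) : exists f, [/\ arr_complement x f,
  val B = connected_component (@arr_complement R n g G x) f & directed (val B) = sign_vector f].
Proof.
have /set_mem[f Af BE] := valP B; exists f; split => //; rewrite BE.
apply/ffunP => e; rewrite !ffunE; apply/asboolP/idP => [|f0 f' /component_sign].
  by apply; exact: connected_component_refl.
by move=> /ffunP/(_ e); rewrite !ffunE f0.
Qed.

Lemma directed_inj : injective (fun B : F_chambers G x => directed (val B)).
Proof.
move=> B B' /=; have [f [Af BE ->]] := chamberE B; have [f' [Af' BE' ->]] := chamberE B'.
move=> ff'; apply: val_inj; rewrite /= BE BE'; apply: same_connected_component.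
by apply: sign_component.
Qed.

(** Makes the existence of a chamber a feasibility question for positive flows, obtained as absolute
    values of a flow in the chamber. *)
Lemma chamber_directedP o : (exists B : F_chambers G x, directed (val B) = o) <->
  (exists h, directed_flow o (x 0) h).
Proof.
split=> [[B]|[h [h0 hx]]].
  have [f [/arr_complementP[/flowsP fx nf] _ ->] <-] := chamberE B.
  exists (fun e => if sign_vector f e then f 0 e else - f 0 e); split.
    move=> e; have := nf e; rewrite ffunE; case: (ltgtP 0 (f 0 e)) => // fe _.
    by rewrite oppr_gt0.
  by move=> v; rewrite netP fx.
pose f : 'rV[R]_(nedge G) := \row_e (if o e then h e else - h e).
have fo : sign_vector f = o.
  by apply/ffunP => e; rewrite ffunE mxE; case: (o e); rewrite ?h0 // oppr_gt0 ltNge ltW.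
have Af : arr_complement x f.
  apply/arr_complementP; split; last first.
    by move=> e; rewrite mxE; case: (o e); rewrite ?oppr_eq0 gt_eqF.
  apply/flowsP => v; rewrite -hx -(netP o); rewrite /net; congr (_ - _); apply: eq_bigr => e _;
    by rewrite mxE; case: (o e); rewrite ?opprK.
have FB : F_chambers G x (connected_component (@arr_complement R n g G x) f) by exists f.
pose B : F_chambers G x := SigSub (mem_set FB); exists B.
have [f' [Af' BE ->]] := chamberE B; rewrite -fo; apply: component_sign.
have -> : connected_component (@arr_complement R n g G x) f = val B by [].
by rewrite BE; exact: connected_component_refl.
Qed.

End Chambers.

(** * Signs of partial sums on adjacent H-chambers *)

Section WallAdjacency.
Variables (R : realType) (n : nat).
Implicit Types (x : 'rV[R]_n) (I J : {set 'I_n}) (c : set 'rV[R]_n).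

Lemma H_chamber_off_walls c x : H_chambers c -> c x -> off_walls x.
Proof. by move=> [x0 _ ->]; exact: connected_component_sub. Qed.

Lemma off_walls_total x : off_walls x -> \sum_i x 0 i = 0.
Proof. by case. Qed.

Lemma off_walls_sum_neq0 x J : off_walls x -> wall_index J -> \sum_(j in J) x 0 j != 0.
Proof. by case=> x0 nw wJ; apply/eqP => xJ; apply: nw; exists J. Qed.

Lemma H_chamber_sign c x x' J : H_chambers c -> wall_index J -> c x -> c x' ->
  0 < \sum_(j in J) x 0 j -> 0 < \sum_(j in J) x' 0 j.
Proof.
move=> Hc wJ cx cx'.
have cc : connected c by case: Hc => x0 _ ->; exact: component_connected.
apply: (connected_sign cc (@continuous_sum_coord R n J)) => // z cz.
exact: off_walls_sum_neq0 (H_chamber_off_walls Hc cz) wJ.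
Qed.

(** The difference of the unit vectors at an index in [J] and one outside [J], both on the same side
    of [I]. If there is no such pair, [J] is [I] or its complement. *)
Lemma wall_direction I J : wall_index J -> J != I -> J != finset.setC I ->
  exists d : 'rV[R]_n, [/\ \sum_i d 0 i = 0, \sum_(i in I) d 0 i = 0
                        & \sum_(i in J) d 0 i = 1].
Proof.
case/andP=> J0 JT JI JIc.
have [/existsP[i /andP[iJ /existsP[k /andP[kJ /eqP ik]]]]|none] := boolP
    [exists i, (i \in J) && [exists k, (k \notin J) && ((i \in I) == (k \in I))]].
  pose d : 'rV[R]_n := \row_j ((j == i)%:R - (j == k)%:R).
  have sumd (K : {set 'I_n}) : \sum_(j in K) d 0 j = (i \in K)%:R - (k \in K)%:R.
    have one a : \sum_(j in K) (j == a)%:R = (a \in K)%:R :> R.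
      have [aK|aK] := boolP (a \in K).
        by rewrite (bigD1 a) //= eqxx big1 ?addr0 // => j /andP[_ /negPf->].
      by rewrite big1 // => j jK; case: eqP jK => [->|//]; rewrite (negPf aK).
    by rewrite (eq_bigr _ (fun j _ => mxE _ _ _ _)) sumrB !one.
  exists d; rewrite -sum_setT !sumd iJ (negPf kJ) ik !inE !subrr subr0; by split.
have {}none i k : i \in J -> k \notin J -> (i \in I) = (k \notin I).
  move=> iJ kJ; apply/eqP/negPn/negP => ik; case/negP: none; apply/existsP; exists i.
  rewrite iJ; apply/existsP; exists k; rewrite kJ /=.
  by move: ik; case: (i \in I); case: (k \in I).
have [i iJ] := set0Pn _ J0.
have [k _ kJ] : exists2 k, k \in [set: 'I_n]%SET & k \notin J by apply/subsetPn; rewrite subTset.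
have [iI|iI] := boolP (i \in I).
  case/eqP: JI; apply/setP => l; apply/idP/idP => [lJ|lI].
    by rewrite (none l k) // -(none i k).
  by apply/negPn/negP => lJ; have := none i l iJ lJ; rewrite iI lI.
case/eqP: JIc; apply/setP => l; rewrite inE; apply/idP/idP => [lJ|lI].
  by rewrite (none l k) // -(none i k).
by apply/negPn/negP => lJ; have := none i l iJ lJ; rewrite (negPf iI) lI.
Qed.

(* Both half-spaces of [J] meet the wall of [I] in a relatively open set only if
   the wall of [I] is the wall of [J]. *)
Lemma adjacent_sum_ge0 I c1 c2 x1 x2 J : H_chambers c1 -> H_chambers c2 ->
    adjacent_across I c1 c2 -> c1 x1 -> c2 x2 -> 0 < \sum_(i in I) x2 0 i ->
  J != I -> 0 <= \sum_(j in J) x2 0 j -> 0 <= \sum_(j in J) x1 0 j.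
Proof.
move=> H1 H2 [U [oU [p [Up Ip]] Usub]] c1x1 c2x2 pos JI J2.
have [off1 off2] := (H_chamber_off_walls H1 c1x1, H_chamber_off_walls H2 c2x2).
have [J0|J0] := eqVneq J finset.set0; first by rewrite J0 big_set0.
have [JT|JT] := eqVneq J [set: 'I_n]%SET; first by rewrite JT sum_setT off_walls_total.
have [JIc|JIc] := eqVneq J (finset.setC I).
  by move: J2; rewrite JIc sum_setC ?off_walls_total // oppr_ge0 leNgt pos.
have wJ : wall_index J by rewrite /wall_index J0.
have wJc : wall_index (finset.setC J).
  by apply/andP; split; [apply: contraNneq JT|apply: contraNneq J0] => E;
    rewrite -[J]finset.setCK E ?finset.setC0 ?finset.setCT.
rewrite leNgt; apply/negP => J1.
have cl2 z : topology_structure.closure c2 z -> 0 <= \sum_(j in J) z 0 j.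
  apply: (closure_ge0 (@continuous_sum_coord R n J)) => y cy; apply/ltW.
  by apply: (H_chamber_sign H2 wJ c2x2 cy); rewrite lt_def J2 off_walls_sum_neq0.
have cl1 z : topology_structure.closure c1 z -> 0 <= \sum_(j in finset.setC J) z 0 j.
  apply: (closure_ge0 (@continuous_sum_coord R n (finset.setC J))) => y cy; apply/ltW.
  apply: (H_chamber_sign H1 wJc c1x1 cy).
  by rewrite sum_setC ?off_walls_total // oppr_gt0.
have zero z : U z -> wall I z -> \sum_(j in J) z 0 j = 0.
  move=> Uz Iz; have [z1 z2] := Usub z (conj Uz Iz); apply/le_anti/andP; split.
    by have := cl1 z z1; rewrite sum_setC ?oppr_ge0 //; case: Iz.
  exact: cl2.
(* A short move along [d] stays in [U] and in the wall of [I], but changes the sum over [J] from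
   zero to [t]. *)
have [d [dT dI dJ]] := wall_direction wJ JI JIc.
have [t t0 Ut] := open_line d oU Up.
have sumt (K : pred 'I_n) : \sum_(j | K j) (p + t *: d) 0 j =
    \sum_(j | K j) p 0 j + t * \sum_(j | K j) d 0 j.
  by rewrite mulr_sumr -big_split /=; apply: eq_bigr => j _; rewrite !mxE.
have := zero _ Ut; rewrite sumt (zero p Up Ip) dJ add0r mulr1 => t00.
by move: t0; rewrite t00 ?ltxx //; case: Ip => pT pI;
  split; rewrite /= /Vspace /= sumt ?dT ?dI mulr0 addr0.
Qed.

End WallAdjacency.

(** * Existence of chambers and nonemptiness of cones *)

Section ChamberCriteria.
Variables (R : realType) (n g : nat) (G : xgraph n g) (I : {set 'I_n}).
Implicit Types (x : 'rV[R]_n) (o : orientation G) (E : {set 'I_(nedge G)}).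

(** Infeasibility yields a vertex set without entering edges whose supply is not positive. Off the
    walls this supply is negative unless the set carries no ends or all of them, so [sum_cuts_eq0]
    applies. *)
Lemma sum_cuts_not_chamber o E x1 x2 : crossing I o (x1 0) (x2 0) -> off_walls x1 ->
    ~ (exists B : F_chambers G x1, directed (val B) = reverse o E) ->
  \sum_(C in Cuts I o | E \subset C) (-1) ^+ rk C = 0 :> int.
Proof.
move=> cross off1 nB; apply: contrapT => s0; apply: nB; apply/chamber_directedP.
apply: directed_flow_exists; first exact: off_walls_total.
move=> T Tin T0 TT; rewrite ltNge; apply/negP => sT; apply: s0.
apply: (sum_cuts_eq0 cross Tin T0 TT); set J := finset.preimset _ _ in sT *.
have [->|J0] := eqVneq J finset.set0; first by constructor 1.
have [->|JT] := eqVneq J finset.setT; first by constructor 2.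
by constructor 3; rewrite lt_neqAle sT off_walls_sum_neq0 // /wall_index J0.
Qed.

(** At a sink or source all terms of the conservation law have the same sign and must vanish.
    Trivalence gives an incident edge or end, whose value is not zero. *)
Lemma sink_or_source_no_flow o x : off_walls x -> wall_index I ->
  has_sink_or_source x o -> ~ (exists h, directed_flow o (x 0) h).
Proof.
move=> off wI [v vss] [h [h0 hv]]; have := hv v; rewrite /net.
(* Since [I] and its complement are nonempty, a single index is a proper subset and defines a
   wall. *)
have x0 i : x 0 i != 0.
  have := off_walls_sum_neq0 (J := finset.set1 i) off; rewrite big_set1; apply.
  apply/andP; split; first by apply/set0Pn; exists i; rewrite inE.
  have [[a aI] [b bI]] := (wall_index_in wI, wall_index_notin wI).
  apply/eqP => /setP E; have := E a; have := E b; rewrite !inE => /eqP bi /eqP ai.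
  by rewrite ai -bi (negPf bI) in aI.
have triv : [exists e, (start o e == v) || (stop o e == v)] || [exists i, att G i == v].
  apply: contraT; rewrite negb_or => /andP[/existsPn ne /existsPn ni].
  have ne' e : (src e == v = false) /\ (tgt e == v = false).
    have := ne e; rewrite /start /stop negb_or.
    by case: (o e) => /andP[/negPf ? /negPf ?].
  have := xgraph_trivalent v.
  have -> : [set e | src e == v]%SET = finset.set0.
    by apply/setP => e; rewrite !inE; case: (ne' e).
  have -> : [set e | tgt e == v]%SET = finset.set0.
    by apply/setP => e; rewrite !inE; case: (ne' e).
  have -> : [set i | att G i == v]%SET = finset.set0.
    by apply/setP => i; rewrite !inE; exact: negPf (ni i).
  by rewrite !cards0.
case: vss => -[noe sgn].
  rewrite [X in X - _]big1 => [|e /eqP ev]; last by have := noe e; rewrite ev eqxx.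
  rewrite sub0r => E; have hs : 0 <= \sum_(e | stop o e == v) h e.
    by apply: sumr_ge0 => e _; apply/ltW.
  have xs : 0 <= inflow (x 0) v by apply: sumr_ge0 => i /eqP/sgn.
  have hs0 : \sum_(e | stop o e == v) h e = 0 by lra.
  have xs0 : inflow (x 0) v = 0 by lra.
  case/orP: triv => /existsP[].
    move=> e; rewrite (negPf (noe e)) /= => ev.
    have := psumr_eq0P (fun e _ => ltW (h0 e)) hs0 ev => he.
    by have := h0 e; rewrite he ltxx.
  move=> i iv; have := psumr_eq0P (fun i (iv : att G i == v) => sgn i (eqP iv)) xs0 iv => xi.
  by have := x0 i; rewrite xi eqxx.
rewrite [X in _ - X]big1 => [|e /eqP ev]; last by have := noe e; rewrite ev eqxx.
rewrite subr0 => E; have hs : 0 <= \sum_(e | start o e == v) h e.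
  by apply: sumr_ge0 => e _; apply/ltW.
have [/existsP[i iv]|/existsPn ni] := boolP [exists i, att G i == v].
  have : inflow (x 0) v < 0.
    rewrite /inflow (bigD1 i) //= ltr_nwDl ?sgn ?(eqP iv) //.
    by apply: sumr_le0 => k /andP[/eqP kv _]; apply/ltW/sgn.
  by rewrite -E ltNge hs.
have hs0 : \sum_(e | start o e == v) h e = 0.
  by rewrite E /inflow big1 // => i iv; have := ni i; rewrite iv.
case/orP: triv => /existsP[]; last by move=> i; rewrite (negPf (ni i)).
move=> e; rewrite (negPf (noe e)) orbF => ev.
have := psumr_eq0P (fun e _ => ltW (h0 e)) hs0 ev => he.
by have := h0 e; rewrite he ltxx.
Qed.

(* A flow that vanishes on [S] carries nothing across a cut contained in [S]. *)
Lemma cut_sub_cone_edges o (S C : {set 'I_(nedge G)}) x : Vspace x ->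
    0 < \sum_(i in I) x 0 i -> wall_index I -> cone_edges R S ->
  C \in Cuts I o -> C \subset S -> C = finset.set0.
Proof.
move=> Vx pos wI coneS; rewrite inE => /orP[/eqP//|/asboolP[_ ends _ _ _]] CS.
have [f [/flowsP fx f0]] := coneS x Vx.
have [i iI] := wall_index_in wI.
pose T := [set v | component C v == component C (att G i)]%SET.
have := sum_inflow (x 0) T; rewrite (eq_bigr _ (fun v _ => esym (fx v))) sum_net.
rewrite big1 => [|e _]; last first.
  have [eC|eC] := boolP (e \in C); first by rewrite (f0 e) ?mul0r //= (subsetP CS).
  have := component_edge [ffun=> true] eC; rewrite /start /stop ffunE => E.
  by rewrite !inE E subrr mulr0.
rewrite /supply (_ : finset.preimset _ _ = I) => [E|]; first by rewrite -E ltxx in pos.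
apply/setP => k; rewrite !inE; apply/eqP/idP => [/componentP|kI].
  by rewrite ends iI => /eqP/esym; case: (k \in I).
by apply/componentP; rewrite ends kI iI.
Qed.

(** Each edge outside [S] is doubled into two opposite arcs. The closed sets are then those that no
    such edge crosses; their supply is zero, so [transshipment] applies. *)
Lemma undirected_flow (S : {set 'I_(nedge G)}) x : Vspace x ->
    (forall T : {set 'I_(nvert G)},
      (forall e, e \notin S -> (src e \in T) = (tgt e \in T)) -> supply (x 0) T = 0) ->
  flat x S !=set0.
Proof.
move=> Vx bal.
pose tl (p : 'I_(nedge G) * bool) : 'I_(nvert G) := if p.2 then src p.1 else tgt p.1.
pose hd (p : 'I_(nedge G) * bool) : 'I_(nvert G) := if p.2 then tgt p.1 else src p.1.
have [||h [_ hK hv]] := @transshipment _ _ _ tl hd [set p | p.1 \notin S]%SET (inflow (x 0)).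
- by rewrite sum_inflow_setT.
- move=> T /closed_underP clT; rewrite sum_inflow bal // => e eS.
  have := clT (e, true); have := clT (e, false); rewrite !inE /= => /(_ eS) ts /(_ eS) st.
  by apply/idP/idP.
exists (\row_e (h (e, true) - h (e, false))); split; last first.
  by move=> e /= eS; rewrite /hyperplane /= mxE !hK ?subrr // inE /= eS.
apply/flowsP => v; rewrite -hv /net.
have split2 (q : 'I_(nedge G) * bool -> 'I_(nvert G)) :
    \sum_(p | q p == v) h p =
    \sum_(e | q (e, true) == v) h (e, true) + \sum_(e | q (e, false) == v) h (e, false).
  transitivity (\sum_p (if q (p.1, p.2) == v then h (p.1, p.2) else 0)).
    by rewrite big_mkcond; apply: eq_bigr => -[].
  rewrite -(pair_bigA _ (fun e b => if q (e, b) == v then h (e, b) else 0)) /=.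
  rewrite [in RHS]big_mkcond [X in _ + X]big_mkcond -big_split /=.
  by apply: eq_bigr => e _; rewrite big_bool.
rewrite !split2 /tl /hd /= !(eq_bigr _ (fun e _ => mxE _ _ _ _)) !sumrB; lra.
Qed.

(** If all edges between some [T] and its complement lie in [S] and the supply of [T] is nonzero,
    directing them against this supply leaves no flow. If there is no such [T], [undirected_flow]
    gives a flow vanishing on [S] for every boundary value. *)
Lemma not_cone_edges (S : {set 'I_(nedge G)}) x : off_walls x -> ~ cone_edges R S ->
  exists o : orientation G, forall B : F_chambers G x,
    ~~ [forall e in S, directed (val B) e == o e].
Proof.
move=> off ncone; apply: contrapT => agree; apply: ncone => y Vy.
apply: undirected_flow => // T sep.
have [J0|J0] := eqVneq (finset.preimset (att G) (mem T)) finset.set0.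
  by rewrite /supply J0 big_set0.
have [JT|JT] := eqVneq (finset.preimset (att G) (mem T)) finset.setT.
  by rewrite /supply JT sum_setT.
have sT : supply (x 0) T != 0 by rewrite off_walls_sum_neq0 // /wall_index J0.
exfalso; apply: agree.
exists [ffun e => if 0 < supply (x 0) T then tgt e \in T else src e \in T] => B.
apply/negP => /forall_inP agree; have [f [/arr_complementP[/flowsP fx nf] _ dirB]] := chamberE B.
have := sum_inflow (x 0) T; rewrite (eq_bigr _ (fun v _ => esym (fx v))) sum_net.
have edge e : (src e \in T) != (tgt e \in T) -> (0 < f 0 e) =
    (if 0 < supply (x 0) T then tgt e \in T else src e \in T).
  move=> ne; have eS : e \in S by apply: contraNT ne => /sep->.
  by have /eqP := agree e eS; rewrite dirB !ffunE.
move: sT; rewrite neq_lt => /orP[sT|sT] E.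
  suff : 0 <= supply (x 0) T by rewrite leNgt sT.
  rewrite -E; apply: sumr_ge0 => e _; have := edge e; rewrite [0 < supply _ _]ltNge (ltW sT) /=.
  case: (src e \in T); case: (tgt e \in T) => /=; rewrite ?subrr ?mulr0 // => /(_ isT).
    by move=> fe; rewrite subr0 mulr1 ltW.
  by move=> /negbT; rewrite -leNgt sub0r mulrN1 oppr_ge0.
suff : supply (x 0) T <= 0 by rewrite leNgt sT.
rewrite -E; apply: sumr_le0 => e _; have := edge e; rewrite sT.
case: (src e \in T); case: (tgt e \in T) => /=; rewrite ?subrr ?mulr0 // => /(_ isT).
  by move=> /negbT; rewrite -leNgt subr0 mulr1.
by move=> fe; rewrite sub0r mulrN1 oppr_le0 ltW.
Qed.

End ChamberCriteria.

(** * The space of chambers *)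

Section ChamberSpace.
Variables (R : realType) (n g : nat) (G : xgraph n g) (x : 'rV[R]_n).
Implicit Types (u v : F_chambers G x -> R^o) (o : orientation G) (S E : {set 'I_(nedge G)}).

Lemma chamber_ofE o (B : F_chambers G x) : chamber_of x o B = (directed (val B) == o)%:R.
Proof.
rewrite /chamber_of; case: pselect => [exB|nB]; last first.
  by case: eqP => // BE; case: nB; exists B.
rewrite /chamber_basis; case: cid => B' /= B'o; congr (nat_of_bool _)%:R.
by apply/eqP/eqP => [->//|Bo]; apply: directed_inj; rewrite /= B'o.
Qed.

(** Sign vectors determine chambers, so there are finitely many; a list of them turns the inner
    product into an ordinary finite sum. *)
Lemma dotCh_seq : exists s : seq (F_chambers G x),
  [/\ uniq s, forall B : F_chambers G x, B \in s
  & forall u v, dotCh u v = \sum_(B <- s) u B * v B].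
Proof.
have fin : finite_set [set: F_chambers G x].
  rewrite -(preimage_setT (fun B : F_chambers G x => directed (val B))).
  apply: finite_preimage; last exact: finite_finset.
  by move=> B B' _ _; exact: directed_inj.
exists (finmap.enum_fset (fset_set [set: F_chambers G x])); split.
- exact: finmap.fset_uniq.
- by move=> B; have := in_fset_set fin B; rewrite mem_setT.
- by move=> u v; rewrite /dotCh fsbig_finite.
Qed.

Lemma dotCh_basisl (B : F_chambers G x) v : dotCh (chamber_basis B) v = v B.
Proof.
have [s [us sB ->]] := dotCh_seq; rewrite (bigD1_seq B) //= /chamber_basis eqxx mul1r.
by rewrite big1 ?addr0 // => B' /negPf ->; rewrite mul0r.
Qed.

Lemma dotCh_basisr (B : F_chambers G x) u : dotCh u (chamber_basis B) = u B.
Proof.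
have [s [us sB ->]] := dotCh_seq; rewrite (bigD1_seq B) //= /chamber_basis eqxx mulr1.
by rewrite big1 ?addr0 // => B' /negPf ->; rewrite mulr0.
Qed.

Lemma dotCh0l v : dotCh 0 v = 0.
Proof. by have [s [_ _ ->]] := dotCh_seq; rewrite big1 // => B _; rewrite mul0r. Qed.

Lemma dotChBl u u' v : dotCh (u - u') v = dotCh u v - dotCh u' v.
Proof.
have [s [_ _ dE]] := dotCh_seq; rewrite !dE -sumrB; apply: eq_bigr => B _.
by rewrite -mulrBl.
Qed.

Lemma dotChZr u v (c : R) : dotCh u (c *: v) = c * dotCh u v.
Proof.
have [s [_ _ dE]] := dotCh_seq; rewrite !dE big_distrr /=; apply: eq_bigr => B _.
by rewrite mulrCA.
Qed.

Lemma dotCh_sumr (J : Type) (r : seq J) (P : pred J) u (F : J -> (F_chambers G x -> R^o)) :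
  dotCh u (\sum_(j <- r | P j) F j) = \sum_(j <- r | P j) dotCh u (F j).
Proof.
have [s [_ _ dE]] := dotCh_seq; rewrite !dE (eq_bigr _ (fun j _ => dE u (F j))).
rewrite exchange_big /=; apply: eq_bigr => B _.
by rewrite fct_sumE big_distrr.
Qed.

Lemma dotCh_cone_chamber S o o' : dotCh (cone S o x) (chamber_of x o') =
  (`[< exists B : F_chambers G x, directed (val B) = o' >] &&
   [forall e in S, o' e == o e])%:R.
Proof.
have [s [us sB ->]] := dotCh_seq.
have [[B Bo']|nB] := asboolP (exists B : F_chambers G x, directed (val B) = o').
  rewrite (bigD1_seq B) //= chamber_ofE Bo' eqxx mulr1 /cone Bo' big1 ?addr0 // => B' B'B.
  rewrite chamber_ofE; case: eqP => [B'o'|]; rewrite ?mulr0 //.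
  by case/eqP: B'B; apply: directed_inj; rewrite /= B'o' Bo'.
rewrite big1 // => B _; rewrite chamber_ofE; case: eqP => [Bo'|]; rewrite ?mulr0 //.
by case: nB; exists B.
Qed.

Lemma cone_setT (B : F_chambers G x) : cone [set: _]%SET (directed (val B)) x = chamber_basis B.
Proof.
apply/funext => B'; rewrite /cone /chamber_basis; congr (nat_of_bool _)%:R.
apply/forall_inP/eqP => [BB'|-> //].
by apply: directed_inj; apply/ffunP => e; apply/eqP; apply: BB'; exact: finset.in_setT.
Qed.

Lemma cone_split S o e : e \in S ->
  cone S o x = cone (S :\ e)%SET o x - cone S (reverse o [set e]%SET) x.
Proof.
move=> eS; apply/funext => B; rewrite -[RHS]/(cone _ _ x B - cone _ _ x B) /cone.
move: (directed (val B)) => d.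
have splitS o' : [forall f in S, d f == o' f] =
    (d e == o' e) && [forall f in (S :\ e)%SET, d f == o' f].
  apply/forall_inP/andP => [all|[de /forall_inP all] f fS].
    by split; [apply: all|apply/forall_inP => f fS; apply: all; case/setD1P: fS].
  by have [->//|fe] := eqVneq f e; apply: all; apply/setD1P.
have same : [forall f in (S :\ e)%SET, d f == reverse o [set e]%SET f] =
    [forall f in (S :\ e)%SET, d f == o f].
  apply: eq_forallb_in => f /setD1P[fe _]; by rewrite ffunE inE (negPf fe) addbF.
rewrite !splitS same ffunE inE eqxx addbT.
by case: (d e); case: (o e); case: [forall _ in _, _]; rewrite ?subr0 ?subrr.
Qed.

(* Cones generate: if the hyperplanes of [S] have no common point, then some
   orientation of [S] bounds an empty cone, and reversing the edges of [S] one by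
   one relates all other cones on [S] to cones on fewer edges. *)
Lemma cone_ind (Y : (F_chambers G x -> R^o) -> Prop) : off_walls x -> Y 0 ->
    (forall u v, Y u -> Y v -> Y (u - v)) ->
    (forall S o, cone_edges R S -> Y (cone S o x)) ->
  forall S o, Y (cone S o x).
Proof.
move=> off Y0 YB Ycone S o; have [m] := ubnP #|S|; elim: m S o => // m IHm S o /ltnSE leSm.
have [coneS|ncone] := pselect (cone_edges R S); first exact: Ycone.
have [q q0] := not_cone_edges off ncone.
pose diff (p : orientation G) := [set e in S | p e != q e]%SET.
(* Inner induction on the number of edges of [S] at which [o] differs from the empty cone [q]. *)
have [k] := ubnP #|diff o|; elim: k o => // k IHk o /ltnSE lek.
have [D0|/set0Pn[e]] := eqVneq (diff o) finset.set0.
  suff -> : cone S o x = 0 by [].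
  apply/funext => B; rewrite /cone.
  have /negPf -> // : ~~ [forall e in S, directed (val B) e == o e].
  apply: contra (q0 B) => /forall_inP Bo.
  apply/forall_inP => e eS; rewrite (eqP (Bo e eS)); apply/negPn/negP => ne.
  by have := in_set0 e; rewrite -D0 inE eS ne.
rewrite inE => /andP[eS ne]; rewrite (cone_split _ eS); apply: YB.
  by apply: IHm; rewrite (leq_trans _ leSm) // [in leqRHS](cardsD1 e) eS.
apply: IHk; apply: leq_trans lek.
apply: proper_card; apply/properP; split.
  apply/fintype.subsetP => f; rewrite !inE => /andP[-> /=]; rewrite ffunE inE.
  have [->|_] := eqVneq f e; last by rewrite addbF.
  by move: ne; case: (o e); case: (q e).
exists e; rewrite inE ?eS //= negbK ffunE inE eqxx.
by move: ne; case: (o e); case: (q e).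
Qed.

End ChamberSpace.

(* The reversals that keep the partial orientation of a cone contribute only
   through the empty cut, every other cut having an edge off the cone. *)
Lemma signed_cuts_cone n g (G : xgraph n g) (I : {set 'I_n}) (o o' : orientation G)
    (S : {set 'I_(nedge G)}) :
    {in Cuts I o, forall C : {set 'I_(nedge G)}, C \subset S -> C = finset.set0} ->
  \sum_(C in Cuts I o) (-1) ^+ rk C *
    signed_sum C (fun E => [forall e in S, reverse o E e == o' e]) =
  [forall e in S, o e == o' e]%:R.
Proof.
move=> cutS; have in0 : finset.set0 \in Cuts I o by rewrite inE eqxx.
rewrite (bigD1 finset.set0) //= big1 => [|C /andP[cutC C0]]; last first.
  have /fintype.subsetPn[e eC eS] : ~~ (C \subset S) by apply: contraNN C0 => /(cutS C cutC)/eqP.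
  rewrite (signed_sum_irrelevant eC) ?mulr0 // => E _ _.
  apply: eq_forallb_in => f fS; rewrite !ffunE in_setU1.
  by have -> : f == e = false by apply: contraNF eS => /eqP<-.
rewrite addr0 rk_set0 mul1r signed_sum0; congr (nat_of_bool _)%:R.
by apply: eq_forallb_in => f _; rewrite ffunE inE addbF.
Qed.

(** * The adjoint on a chamber and the vanishing coefficients *)

Theorem lemma6p12 (R : realType) (n g : nat) (I : {set 'I_n})
    (hI : wall_index I) (c1 c2 : set 'rV[R]_n)
    (hc1 : H_chambers c1) (hc2 : H_chambers c2)
    (hadj : adjacent_across I c1 c2)
    (hneg : forall x, c1 x -> \sum_(i in I) x 0 i < 0)
    (hpos : forall x, c2 x -> 0 < \sum_(i in I) x 0 i)
    (x1 x2 : 'rV[R]_n) (hx1 : c1 x1) (hx2 : c2 x2)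
    (G : xgraph n g)
    (hbad : exists2 x : 'rV[R]_n, wall I x & bad_nontransverse G x)
    (nabla : {linear RCh G x1 -> RCh G x2})
    (nablaT : {linear RCh G x2 -> RCh G x1})
    (hnabla : is_gauss_manin nabla) (hnablaT : is_adjoint nabla nablaT)
    (A : F_chambers G x2) :
  nablaT (chamber_basis A) =
    \sum_(C in Cuts I (directed (val A)))
      (-1) ^+ rk C *:
        \sum_(E in powerset C)
          (-1) ^+ #|E| *: chamber_of x1 (reverse (directed (val A)) E)
  /\
  forall E : {set 'I_(nedge G)}, E \subset cuttable I (directed (val A)) ->
    has_sink_or_source x1 (reverse (directed (val A)) E) \/
    ((exists2 B : F_chambers G x2,
        B <> A & directed (val B) = reverse (directed (val A)) E) /\
     ~ (exists B : F_chambers G x1,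
          directed (val B) = reverse (directed (val A)) E)) ->
    \sum_(C in Cuts I (directed (val A)) | E \subset C) (-1) ^+ rk C = 0 :> int.
Proof.
have off1 := H_chamber_off_walls hc1 hx1; have off2 := H_chamber_off_walls hc2 hx2.
set o := directed (val A).
have [h oh] : exists h, directed_flow o (x2 0) h by apply/chamber_directedP; exists A.
(* The positive flow given by [A] yields the supply condition, and adjacency across the wall the
   comparison of the other partial sums. *)
have cross : crossing I o (x1 0) (x2 0).
  split; [exact: off_walls_total|exact: off_walls_total|exact: hneg|exact: hpos| |].
    by move=> J; apply: (adjacent_sum_ge0 hc1 hc2 hadj hx1 hx2); exact: hpos.
  by move=> T; apply: directed_flow_closed oh.
have cuts0 E : ~ (exists B : F_chambers G x1, directed (val B) = reverse o E) ->
    \sum_(C in Cuts I o | E \subset C) (-1) ^+ rk C = 0 :> int.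
  exact: (sum_cuts_not_chamber cross off1).
split; last first.
  move=> E _ [vss|[_ nB]]; apply: cuts0 => //.
  by move=> /chamber_directedP; apply: (sink_or_source_no_flow off1 hI).
set rhs := \sum_(C in _) _.
(* Testing against basis vectors moves the claim from the adjoint to [nabla], whose values on cones
   are known. *)
suff dual B : nabla (chamber_basis B) A = dotCh (chamber_basis B) rhs.
  apply/funext => B; rewrite -[LHS]dotCh_basisl -hnablaT dotCh_basisr.
  by rewrite dual dotCh_basisl.
(* A basis vector is the cone prescribing every edge, and both sides are additive, so the cones with
   [cone_edges] suffice. *)
rewrite -cone_setT; apply: (cone_ind (Y := fun u => nabla u A = dotCh u rhs)) => //.
- by rewrite raddf0 dotCh0l.
- by move=> u v Yu Yv; rewrite raddfB dotChBl -Yu -Yv.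
- move=> S o' coneS; rewrite hnabla // /rhs dotCh_sumr.
  have cutS : {in Cuts I o, forall C : {set 'I_(nedge G)}, C \subset S -> C = finset.set0}.
    by move=> C; apply: (cut_sub_cone_edges off2.1 (hpos _ hx2) hI coneS).
  pose b E := `[< exists B : F_chambers G x1, directed (val B) = reverse o E >] &&
              [forall e in S, reverse o E e == o' e].
  transitivity ((\sum_(C in Cuts I o) (-1) ^+ rk C * signed_sum C b)%:~R : R); last first.
    rewrite rmorph_sum; apply: eq_bigr => C _; rewrite dotChZr dotCh_sumr.
    rewrite rmorphM rmorph_sign; congr (_ * _); rewrite /signed_sum rmorph_sum.
    apply: eq_bigr => E _; rewrite dotChZr dotCh_cone_chamber.
    by rewrite rmorphM rmorph_sign /= -/(b E); case: (b E).
  rewrite exchange_signed_sum.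
  under eq_bigr => E _.
    rewrite (_ : _ * _ = (-1) ^+ #|E| * [forall e in S, reverse o E e == o' e]%:R *
      \sum_(C in Cuts I o | E \subset C) (-1) ^+ rk C); last first.
      rewrite /b; case: asboolP => //= /cuts0 ->; by rewrite !mulr0.
    over.
  by rewrite -exchange_signed_sum signed_cuts_cone // /cone -/o; case: [forall _ in _, _].
Qed.
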